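(* Let $d\ge 1$ be an integer, $\beta\ge 0$ and $h\in\mathbb{R}$ be fixed, let $\beta_c=\frac{1}{2d}$, and for $n\ge 1$ let $$Z_{d,\beta,h}=\sum_{\sigma\in\{-1,1\}^n}\exp\Big\{\frac{d\beta}{n}\Big(\sum_{j=1}^n\sigma_j\Big)^2+h\sum_{j=1}^n\sigma_j\Big\}.$$ Then, as $n\to+\infty$, for every integer $M\ge 1$: (1) If $h=0$ and $\beta<\beta_c$, then $$Z_{d,\beta,0}=2^n\Big(\sum_{p=0}^M e_p^{<}n^{-p}+o(n^{-M})\Big),$$ where $e_0^{<}=(1-2d\beta)^{-1/2}$ and for $p\ge 1$ $$e_p^{<}=\sum_{k=1}^p\frac{(2p+2k-1)!!}{k!}(2d\beta)^{p+k}(1-2d\beta)^{-\frac{2p+2k+1}{2}}\sum_{\substack{m_1,\dots,m_k\ge 1\\ m_1+\cdots+m_k=p}}a_{2(m_1+1)}a_{2(m_2+1)}\cdots a_{2(m_k+1)},$$ with $a_{2j}$ ($j\ge 2$) the coefficient of $t^{2j}$ in the Taylor expansion of $\ln\cosh t$ at $t=0$. (2) If $h=0$ and $\beta=\beta_c$, then $$Z_{d,\beta,0}=2^n\Big(\sum_{p=0}^M e_p^{c}n^{-p/2+1/4}+o(n^{-M/2+1/4})\Big),$$ where $e_0^{c}=\frac{1}{\sqrt{2\pi}}\left(\frac34\right)^{1/4}\Gamma(\frac14)$ and for $p\ge 1$ $$e_p^{c}=\frac{1}{\sqrt{2\pi}}\Big(\frac34\Big)^{1/4}\sum_{k=1}^p\frac{12^{\frac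 p2+k}\,\Gamma(\frac p2+k+\frac14)}{k!}\sum_{\substack{m_1,\dots,m_k\ge 1\\ m_1+\cdots+m_k=p}}a_{2m_1+4}a_{2m_2+4}\cdots a_{2m_k+4},$$ with the same $a_{2j}$ as in (1). (3) If $h=0$ and $\beta>\beta_c$, then $$Z_{d,\beta,0}=2^n e^{n\varphi(t_* )}\Big(\sum_{p=0}^M e_p^{>}n^{-p}+o(n^{-M})\Big),$$ where $\varphi(t)=\ln\cosh t-\frac{t^2}{4d\beta}$, $t_*=2d\beta z_*$ with $z_*>0$ the maximal solution of $\tanh\big(\frac{\beta}{\beta_c}z\big)=z$, $$e_0^{>}=2^{1/2}(d\beta)^{-1/2}\Big(\frac{1}{2d\beta}-\frac{1}{\cosh^2 t_*}\Big)^{-1/2},$$ and for $p\ge 1$ $$e_p^{>}=(-d\beta a_2)^{-1/2}\sum_{k=1}^{2p}\frac{(2p+2k-1)!!}{k!}(-2a_2)^{-(p+k)}\sum_{\substack{m_1,\dots,m_k\ge 1\\ m_1+\cdots+m_k=2p}}a_{m_1+2}a_{m_2+2}\cdots a_{m_k+2},$$ with $a_p$ the coefficients in the Taylor expansion $\varphi(t)=\varphi(t_* )+\sum_{p\ge 2}a_p(t-t_* )^p$ near $t_*$ (so that $2a_2=\frac{1}{\cosh^2 t_*}-\frac{1}{2d\beta}<0$). (4) If $h\ne 0$ (and $\beta>0$), then $$Z_{d,\beta,h}=2^n e^{n\varphi(t_* )}\Big(\sum_{p=0}^M e_p^{h\ne 0}n^{-p}+o(n^{-M})\Big),$$ where $\varphi(t)=\ln\cosh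 t-\frac{(t-|h|)^2}{4d\beta}$, $t_*=2d\beta z_*+|h|$ with $z_*>0$ the maximal solution of $\tanh\big(\frac{\beta}{\beta_c}z+|h|\big)=z$, $$e_0^{h\ne 0}=(2d\beta)^{-1/2}\Big(\frac{1}{2d\beta}-\frac{1}{\cosh^2 t_*}\Big)^{-1/2},$$ and for $p\ge 1$ $$e_p^{h\ne 0}=(-4d\beta a_2)^{-1/2}\sum_{k=1}^{2p}\frac{(2p+2k-1)!!}{k!}(-2a_2)^{-(p+k)}\sum_{\substack{m_1,\dots,m_k\ge 1\\ m_1+\cdots+m_k=2p}}a_{m_1+2}a_{m_2+2}\cdots a_{m_k+2},$$ with $a_p$ the coefficients in the Taylor expansion $\varphi(t)=\varphi(t_* )+\sum_{p\ge 2}a_p(t-t_* )^p$ near $t_*$ (so that $2a_2=\frac{1}{\cosh^2 t_*}-\frac{1}{2d\beta}<0$).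
   Context: $Z_{d,\beta,h}$ is the normalizing constant (partition function) of the Curie-Weiss model on $n$ vertices; it depends on $n$, and the parameters $d,\beta,h$ are fixed as $n\to\infty$. $(2m-1)!!=1\cdot 3\cdots(2m-1)$, and $\Gamma$ is the Gamma function. *)

(* Defs.v *)
From HB Require Import structures.
From mathcomp Require Import all_boot all_order all_algebra.
From mathcomp Require Import all_classical all_reals all_analysis.

Set Implicit Arguments.
Unset Strict Implicit.
Unset Printing Implicit Defensive.

Import Order.TTheory GRing.Theory Num.Theory.
Import numFieldNormedType.Exports.

Local Open Scope classical_set_scope.
Local Open Scope ring_scope.

Definition cosh (R : realType) (t : R) : R := (expR t + expR (- t)) / 2.

Definition tanh (R : realType) (t : R) : R :=
  (expR t - expR (- t)) / (expR t + expR (- t)).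

(* Euler's integral; only used at arguments s > 0, where it converges. *)
Definition Gamma (R : realType) (s : R) : R :=
  \int[@lebesgue_measure R]_(x in `]0, +oo[) (x `^ (s - 1) * expR (- x)).

Definition taylor_coef (R : realType) (f : R -> R) (t0 : R) (j : nat) : R :=
  derive1n j f t0 / j`!%:R.

(* odd_dfact m is (2m-1)!! = 1 * 3 * ... * (2m-1); it is 1 for m = 0. *)
Definition odd_dfact (m : nat) : nat := (\prod_(i < m) i.*2.+1)%N.

(* The sum of b(m_1) ... b(m_k) over m_1, ..., m_k >= 1 with
   m_1 + ... + m_k = N; each m_i is then at most N, hence the type 'I_N.+1. *)
Definition composition_sum (R : realType) (b : nat -> R) (k N : nat) : R :=
  \sum_(m : {ffun 'I_k -> 'I_N.+1} |
      [forall i, (0 < m i)%N] && ((\sum_i m i)%N == N))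
    \prod_i b (m i).

Definition spin (R : realType) (s : bool) : R := if s then 1 else -1.

Definition partition_function (R : realType) (d : nat) (beta h : R)
    (n : nat) : R :=
  \sum_(sigma : {ffun 'I_n -> bool})
    expR (d%:R * beta / n%:R * (\sum_j spin R (sigma j)) ^+ 2
          + h * \sum_j spin R (sigma j)).

Definition beta_c (R : realType) (d : nat) : R := 1 / (2 * d%:R).

(* Z_n = A_n (S_n + o(r_n)) as n -> oo *)
Definition expands_as (R : realType) (Z A S r : nat -> R) : Prop :=
  exists2 err : nat -> R,
    (forall n, (1 <= n)%N -> Z n = A n * (S n + err n)) & err =o_\oo r.

Definition maximal_fixpoint (R : realType) (F : R -> R) (z : R) : Prop :=
  F z = z /\ forall y, F y = y -> y <= z.

Definition lncosh (R : realType) (t : R) : R := ln (cosh t).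

Definition e_sub (R : realType) (d : nat) (beta : R) (p : nat) : R :=
  if p == 0%N then (1 - 2 * d%:R * beta) `^ (- (1 / 2))
  else
    \sum_(1 <= k < p.+1)
      (odd_dfact (p + k))%:R / k`!%:R * (2 * d%:R * beta) ^+ (p + k)
      * (1 - 2 * d%:R * beta) `^ (- ((2 * p + 2 * k + 1)%N%:R / 2))
      * composition_sum (fun m => taylor_coef (@lncosh R) 0 (2 * (m + 1))%N) k p.

Definition e_crit (R : realType) (p : nat) : R :=
  if p == 0%N then
    1 / Num.sqrt (2 * pi) * (3 / 4) `^ (1 / 4) * Gamma (1 / 4)
  else
    1 / Num.sqrt (2 * pi) * (3 / 4) `^ (1 / 4) *
    \sum_(1 <= k < p.+1)
      12 `^ (p%:R / 2 + k%:R) * Gamma (p%:R / 2 + k%:R + 1 / 4) / k`!%:R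
      * composition_sum (fun m => taylor_coef (@lncosh R) 0 (2 * m + 4)%N) k p.

Definition phi_zero (R : realType) (d : nat) (beta t : R) : R :=
  ln (cosh t) - t ^+ 2 / (4 * d%:R * beta).

Definition e_super (R : realType) (d : nat) (beta t : R) (p : nat) : R :=
  let a := taylor_coef (phi_zero d beta) t in
  if p == 0%N then
    2 `^ (1 / 2) * (d%:R * beta) `^ (- (1 / 2))
    * (1 / (2 * d%:R * beta) - 1 / cosh t ^+ 2) `^ (- (1 / 2))
  else
    (- (d%:R * beta * a 2%N)) `^ (- (1 / 2)) *
    \sum_(1 <= k < (2 * p).+1%N)
      (odd_dfact (p + k))%:R / k`!%:R * (- (2 * a 2%N)) ^- (p + k)
      * composition_sum (fun m => a (m + 2)%N) k (2 * p)%N.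

Definition phi_field (R : realType) (d : nat) (beta h t : R) : R :=
  ln (cosh t) - (t - `|h|) ^+ 2 / (4 * d%:R * beta).

Definition e_field (R : realType) (d : nat) (beta h t : R) (p : nat) : R :=
  let a := taylor_coef (phi_field d beta h) t in
  if p == 0%N then
    (2 * d%:R * beta) `^ (- (1 / 2))
    * (1 / (2 * d%:R * beta) - 1 / cosh t ^+ 2) `^ (- (1 / 2))
  else
    (- (4 * d%:R * beta * a 2%N)) `^ (- (1 / 2)) *
    \sum_(1 <= k < (2 * p).+1%N)
      (odd_dfact (p + k))%:R / k`!%:R * (- (2 * a 2%N)) ^- (p + k)
      * composition_sum (fun m => a (m + 2)%N) k (2 * p)%N.

(* Main.v *)
Require Import Defs.
From mathcomp Require Import all_boot all_order all_algebra.
From mathcomp Require Import all_classical all_reals all_analysis.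
From mathcomp Require Import measurable_realfun.
From mathcomp Require Import ring lra.

(** Write b = 2 d beta and let S be the sum of the spins. A Gaussian integral
    linearizes the square: exp (b S^2 / (2 n)) is an average of exp (u S) over a normal
    variable u of variance b / n. Once the spins enter linearly their sum factorizes,
    and Z_n becomes 2^n sqrt (n / (2 pi b)) times the integral over the line of
    exp (n phi), with phi (t) = ln cosh t - (t - h)^2 / (2 b)
    ([hubbard_stratonovich]). Each part of the theorem is then Laplace's method
    at the maximizers of phi.

    Near a maximizer, phi equals its maximum - c |t|^r + |t|^r sum_(m >= 1) b_m t^(s m). The
    order r is 2, except at the critical temperature, where the quadratic
    coefficient vanishes and the quartic one is - 1 / 12. The step s is 2 when
    the maximizer is 0, because phi is even there, and 1 otherwise. With
    w = n |t|^r kept as an independent variable, exp (w sum_m b_m t^(s m)) expands in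
    powers of t^s; the coefficient of t^(s N) is
    sum_k w^k / k! times a sum over compositions of N into k parts, because the
    k-th power of a series without constant term has these sums as coefficients
    ([composition_sum_coef]). Integrating term by term against exp (- c w) gives
    values of Gamma ([even_moment]), which for r = 2 are double factorials
    ([Gamma_half_odd]), and powers n^(-(s N + 1) / r).

    The error is controlled pointwise rather than integral by integral. Near 0 the
    truncation costs at most C |t|^(s (P + 1)) exp (- c w / 4)
    ([laplace_local]). Away from 0 both exp (n (phi - max phi)) and the truncated
    expansion are exponentially small, and a fixed lower bound on |t|
    allows inserting the same power of |t| for free. One integration of this bound
    therefore controls local error and tails at once ([laplace_expansion]).

    It remains to locate the maxima. On the positive half-line phi' is concave
    because tanh is, so it vanishes at most once after having been positive, and with
    a negative slope ([mf_maximizer_exists]); in terms of z = tanh t this zero is the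
    maximal fixed point of the statement. Without field
    and for b <= 1, tanh t < t makes 0 the only maximizer; for b > 1 there are two symmetric
    maximizers, and one half-line is integrated and doubled. *)

Set Implicit Arguments.
Unset Strict Implicit.
Unset Printing Implicit Defensive.

Import Order.TTheory GRing.Theory Num.Theory.
Import numFieldNormedType.Exports.

Local Open Scope classical_set_scope.
Local Open Scope ring_scope.

(** * Integrals over subsets of the line, given by their value *)

(** Integrability and value are bundled, so that linear combinations and comparisons of
    improper integrals reduce to computations on real numbers. *)
Definition has_integral {R : realType} (D : set R) (f : R -> R) (v : R) : Prop :=
  [/\ measurable (D : set (measurableTypeR R)), (@lebesgue_measure R).-integrable D (EFin \o f) &
      \int[@lebesgue_measure R]_(x in D) f x = v].

Section has_integral_theory.
Context {R : realType}.
Notation mu := (@lebesgue_measure R).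
Implicit Types (D : set R) (f g h : R -> R) (v w : R).

Lemma has_integralE D f v : has_integral D f v ->
  (\int[mu]_(x in D) (f x)%:E = v%:E)%E.
Proof.
by move=> [mD fi <-]; rewrite /Rintegral fineK//; exact: integrable_fin_num.
Qed.

Lemma ge0_has_integral D f v : measurable (D : set (measurableTypeR R)) ->
  measurable_fun D f ->
  (forall x, D x -> 0 <= f x) -> (\int[mu]_(x in D) (f x)%:E = v%:E)%E ->
  has_integral D f v.
Proof.
move=> mD mf f0 fv; split => //; last by rewrite /Rintegral fv.
apply/integrableP; split; first exact/measurable_EFinP.
under eq_integral => x /[!inE] Dx do rewrite /= ger0_norm ?f0//.
by rewrite fv ltry.
Qed.

Lemma eq_has_integral D f g v : {in D, f =1 g} ->
  has_integral D f v -> has_integral D g v.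
Proof.
move=> fg [mD fi fv]; split => //.
  by move: fi; apply: eq_integrable => // x Dx /=; rewrite fg.
by rewrite -fv; apply: eq_Rintegral => x Dx; rewrite fg.
Qed.

Lemma has_integral0 D : measurable (D : set (measurableTypeR R)) -> has_integral D (fun=> 0) 0.
Proof.
move=> mD; split => //; first exact: integrable0.
by rewrite /Rintegral integral0_eq.
Qed.

Lemma has_integralD D f g v w : has_integral D f v -> has_integral D g w ->
  has_integral D (fun x => f x + g x) (v + w).
Proof.
move=> [mD fi <-] [_ gi <-]; split => //; last exact: RintegralD.
by move: (integrableD mD fi gi); apply: eq_integrable.
Qed.

Lemma has_integralZ D f v (k : R) : has_integral D f v ->
  has_integral D (fun x => k * f x) (k * v).
Proof.
move=> [mD fi <-]; split => //; last exact: RintegralZl.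
by move: (integrableZl mD k fi); apply: eq_integrable.
Qed.

Lemma has_integralB D f g v w : has_integral D f v -> has_integral D g w ->
  has_integral D (fun x => f x - g x) (v - w).
Proof.
move=> Hf /(has_integralZ (-1)) Hg.
rewrite -[- w]mulN1r; apply: eq_has_integral (has_integralD Hf Hg) => x _.
by rewrite mulN1r.
Qed.

Lemma has_integral_sum (I : Type) (s : seq I) (P : pred I) D
    (f : I -> R -> R) (v : I -> R) : measurable (D : set (measurableTypeR R)) ->
  (forall i, P i -> has_integral D (f i) (v i)) ->
  has_integral D (fun x => \sum_(i <- s | P i) f i x) (\sum_(i <- s | P i) v i).
Proof.
move=> mD H; elim: s => [|i s IH].
  rewrite big_nil; apply: eq_has_integral (has_integral0 mD) => x _.
  by rewrite big_nil.
rewrite big_cons; case: ifPn => Pi.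
  apply: eq_has_integral (has_integralD (H _ Pi) IH) => x _.
  by rewrite big_cons Pi.
by apply: eq_has_integral IH => x _; rewrite big_cons (negbTE Pi).
Qed.

Lemma le_has_integral D f g v w : has_integral D f v -> has_integral D g w ->
  (forall x, D x -> f x <= g x) -> v <= w.
Proof. by move=> [mD fi <-] [_ gi <-] fg; exact: le_Rintegral. Qed.

Lemma has_integral_dist D f g h u v w :
  has_integral D f u -> has_integral D g v -> has_integral D h w ->
  (forall x, D x -> `|f x - g x| <= h x) -> `|u - v| <= w.
Proof.
move=> Hf Hg Hh fgh; have Hfg := has_integralB Hf Hg.
rewrite ler_norml; apply/andP; split.
  rewrite -mulN1r; apply: le_has_integral (has_integralZ (-1) Hh) Hfg _ => //.
  by move=> x Dx; rewrite mulN1r; have := fgh x Dx; rewrite ler_norml => /andP[].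
apply: le_has_integral Hfg Hh _ => //.
by move=> x Dx; have := fgh x Dx; rewrite ler_norml => /andP[].
Qed.

(** Domination produces a value without computing it; the value is identified
    afterwards, by symmetry or by a change of variables. *)
Lemma dominated_has_integral D f g w : measurable_fun D f ->
  (forall x, D x -> `|f x| <= g x) -> has_integral D g w ->
  exists v, has_integral D f v.
Proof.
move=> mf fg [mD gi _]; exists (\int[mu]_(x in D) f x); split => //.
move: gi; apply: le_integrable => //; first exact/measurable_EFinP.
by move=> x Dx /=; rewrite lee_fin (le_trans (fg x Dx))// ler_norm.
Qed.

End has_integral_theory.

Section half_line.
Context {R : realType}.
Notation mu := (@lebesgue_measure R).
Implicit Types (f : R -> R) (v : R).

Lemma continuous_compN f : continuous f -> continuous (fun x => f (- x)).
Proof. by move=> cf x; apply: continuous_comp; [exact: opp_continuous|exact: cf]. Qed.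

(** Reflection invariance, obtained by exchanging the two half-lines. *)
Lemma integralT_opp f : continuous f -> (forall x, 0 <= f x) ->
  (\int[mu]_x (f (- x))%:E = \int[mu]_x (f x)%:E)%E.
Proof.
move=> cf f0.
have split_line (g : R -> R) : continuous g -> (forall x, 0 <= g x) ->
    (\int[mu]_x (g x)%:E =
     \int[mu]_(x in `[0%R, +oo[) (g x)%:E +
     \int[mu]_(x in `[0%R, +oo[) (g (- x))%:E)%E.
  move=> cg g0.
  have mg : measurable_fun [set: R] g by exact: continuous_measurable_fun.
  rewrite -(setUv (`[0%R, +oo[ : set R)) ge0_integral_setU//= ; last 4 first.
  - exact: measurableC.
  - by apply/measurable_EFinP; rewrite setUv.
  - by move=> x _; rewrite lee_fin.
  - exact/disj_setPCl.
  congr (_ + _)%E.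
  rewrite setCitvr integral_itv_bndo_bndc; last first.
    exact/measurable_EFinP/measurable_funTS.
  rewrite -{1}oppr0 ge0_integration_by_substitutionNy//.
  exact: continuous_subspaceT.
rewrite [RHS]split_line// split_line//; last exact: continuous_compN.
by rewrite addeC; congr (_ + _)%E; apply: eq_integral => x _; rewrite opprK.
Qed.

(** For odd f, |f| + f is nonnegative and its reflection is |f| - f, so the two have the
    same integral, and f is half their difference. *)
Lemma odd_has_integral f g w : continuous f -> (forall x, f (- x) = - f x) ->
  (forall x, `|f x| <= g x) -> has_integral setT g w -> has_integral setT f 0.
Proof.
move=> cf fodd fg Hg.
have ch : continuous (fun x => `|f x| + f x).
  move=> x; apply: cvgD; last exact: cf.
  by apply: cvg_norm; exact: cf.
have h0 x : 0 <= `|f x| + f x.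
  by rewrite -[f x in X in _ + X]opprK subr_ge0 -normrN ler_norm.
have mh := continuous_measurable_fun ch.
have hg x : setT x -> `| `|f x| + f x| <= 2 * g x.
  move=> _; rewrite ger0_norm//; have := fg x; have := ler_norm (f x); lra.
have [v Hv] := dominated_has_integral (measurable_funS measurableT (@subsetT _ _) mh) hg (has_integralZ 2 Hg).
have hv := has_integralE Hv.
have HvN : has_integral setT (fun x => `|f (- x)| + f (- x)) v.
  apply: ge0_has_integral => //.
    exact: (continuous_measurable_fun (continuous_compN ch)).
  by rewrite (integralT_opp ch h0).
have := has_integralZ 2^-1 (has_integralB Hv HvN).
rewrite subrr mulr0; apply: eq_has_integral => x _.
by rewrite fodd normrN; lra.
Qed.

(** An even integrand splits evenly between the two half-lines; the origin is
    a null set, so it is left out. *)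
Lemma even_has_integral f v : continuous f -> (forall x, 0 <= f x) ->
  (forall x, f (- x) = f x) -> has_integral `]0, +oo[ f v ->
  has_integral setT f (2 * v).
Proof.
move=> cf f0 fe Hv; have fv := has_integralE Hv.
have mf : measurable_fun [set: R] f by exact: continuous_measurable_fun.
apply: ge0_has_integral => //.
rewrite ge0_symfun_integralT//; last by move=> x /=; rewrite fe.
rewrite -set_itvcy -integral_itv_obnd_cbnd; first by rewrite fv -EFinM.
exact/measurable_EFinP/measurable_funTS.
Qed.

Lemma even_has_integral_half f v : continuous f -> (forall x, 0 <= f x) ->
  (forall x, f (- x) = f x) -> has_integral setT f v ->
  (\int[mu]_(x in `[0%R, +oo[) (f x)%:E = (v / 2)%:E)%E.
Proof.
move=> cf f0 fe Hv; have [_ fi _] := Hv; have fv := has_integralE Hv.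
have mf : measurable_fun [set: R] f by exact: continuous_measurable_fun.
move: fv; rewrite ge0_symfun_integralT//; last by move=> x /=; rewrite fe.
rewrite -set_itvcy => fv.
have fi' : mu.-integrable `[0, +oo[ (EFin \o f) by exact: integrableS fi.
have /fineK E : (\int[mu]_(x in `[0%R, +oo[) (f x)%:E)%E \is a fin_num.
  exact: integrable_fin_num.
by move: fv; rewrite -E -EFinM => -[<-]; congr (_%:E); field.
Qed.

End half_line.

(** * Moments of exponentials of powers *)

Section moments.
Context {R : realType}.
Notation mu := (@lebesgue_measure R).

Lemma expR_dominates_power (j : nat) (a : R) : 0 < a ->
  exists2 C : R, 0 < C & forall x, 0 <= x -> x ^+ j * expR (- (a * x)) <= C.
Proof.
move=> a0; exists (j`!%:R / a ^+ j).
  by rewrite divr_gt0 ?exprn_gt0// ltr0n fact_gt0.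
move=> x x0; rewrite expRN ler_pdivrMr ?expR_gt0// mulrAC ler_pdivlMr ?exprn_gt0//.
rewrite -exprMn [x * a]mulrC.
case: j => [|j]; first by rewrite expr0 mul1r -expR0 ler_expR mulr_ge0// ltW.
have ax0 : 0 <= a * x by rewrite mulr_ge0// ltW.
have := expR_ge1Dxn j ax0; set q := (j.+1)`!%:R; have q0 : 0 < q :> R.
  by rewrite ltr0n fact_gt0.
rewrite -ler_pdivrMl// [q^-1 * _]mulrC; set y := _ / q => ?; lra.
Qed.

Lemma has_integral_expR (a : R) : 0 < a ->
  has_integral `]0, +oo[ (fun t => expR (- (a * t))) a^-1.
Proof.
move=> a0.
have cE : continuous (fun t : R => expR (- (a * t))).
  move=> x; apply: continuous_comp; last exact: continuous_expR.
  by apply: cvgN; apply: cvgM; [exact: cvg_cst|exact: cvg_id].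
have mE := continuous_measurable_fun cE.
apply: ge0_has_integral => //; first exact: measurable_funTS.
rewrite integral_itv_obnd_cbnd; last exact/measurable_EFinP/measurable_funTS.
rewrite (@ge0_continuous_FTC2y _ _ (fun x => - a^-1 * expR (- (a * x))) 0 0)//.
- by rewrite mulr0 oppr0 expR0 mulr1 sub0e EFinN oppeK.
- exact: continuous_subspaceT.
- rewrite -[X in _ --> X](mulr0 (- a^-1)); apply: cvgM; first exact: cvg_cst.
  apply: (@cvg_comp _ _ _ (fun x : R => a * x) (fun x : R => expR (- x)) _ +oo%R).
    exact: gt0_cvgMry.
  exact: cvgr_expR.
- by apply: cvg_at_right_filter; apply: cvgM; [exact: cvg_cst|exact: cE].
- move=> x _; rewrite derive1E derive_val.
  rewrite /GRing.scale/=; field; rewrite gt_eqF//.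
Qed.

Lemma continuous_power_exp (j r : nat) (k : R) :
  continuous (fun t : R => t ^+ j * expR (- (k * t ^+ r))).
Proof.
move=> x; apply: cvgM; first exact: exprn_continuous.
apply: continuous_comp; last exact: continuous_expR.
by apply: cvgN; apply: cvgM; [exact: cvg_cst|exact: exprn_continuous].
Qed.

(** Since t^r >= t - 1, the decay is at least exponential. *)
Lemma has_integral_power_exp (j r : nat) (k : R) : (0 < r)%N -> 0 < k ->
  exists v, has_integral `]0, +oo[ (fun t => t ^+ j * expR (- (k * t ^+ r))) v.
Proof.
move=> r0 k0; have k20 : 0 < k / 2 by rewrite divr_gt0.
have [C C0 HC] := expR_dominates_power j k20.
apply: dominated_has_integral (has_integralZ (expR k * C) (has_integral_expR k20)).
  have mE := continuous_measurable_fun (@continuous_power_exp j r k).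
  exact: measurable_funTS.
move=> x /=; rewrite in_itv/= andbT => x0.
have xr : x - 1 <= x ^+ r.
  have [x1|x1] := leP 1 x; last by have := exprn_ge0 r (ltW x0); lra.
  by rewrite (le_trans (y := x)) ?lerBlDr ?lerDl// -[leLHS]expr1 ler_weXn2l.
rewrite ger0_norm; last by rewrite mulr_ge0 ?exprn_ge0 ?expR_ge0// ltW.
apply: (@le_trans _ _ (x ^+ j * (expR k * expR (- (k / 2 * x)) * expR (- (k / 2 * x))))).
  apply: ler_wpM2l; first by rewrite exprn_ge0// ltW.
  rewrite -!expRD ler_expR; have := ler_wpM2l (ltW k0) xr; nra.
have := HC x (ltW x0) => /(ler_wpM2r (expR_ge0 (- (k / 2 * x)))).
move=> /(ler_wpM2l (expR_ge0 k)) H.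
by apply: le_trans (le_trans H _); rewrite le_eqVlt; apply/orP; left; apply/eqP; ring.
Qed.

End moments.

Section gamma_moments.
Context {R : realType}.
Notation mu := (@lebesgue_measure R).

Lemma is_derive_monomial (k : R) (r : nat) (x : R) :
  is_derive x 1 (fun t => k * t ^+ r) (k * (r%:R * x ^+ r.-1)).
Proof.
have H : is_derive x 1 (fun t : R => t ^+ r) (r%:R * x ^+ r.-1).
  have := is_deriveX r (is_derive_id x (1 : R)).
  by rewrite /GRing.scale/= mulr1 exprfctE.
exact: (is_deriveZ k H).
Qed.

Lemma powR_continuous_pos (s x : R) : 0 < x -> {for x, continuous (fun u : R => u `^ s)}.
Proof.
move=> x0; apply: differentiable_continuous; apply/derivable1_diffP.
by apply: derivable_powR; rewrite in_itv/= x0.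
Qed.

Lemma bigcup_monomial_itv (k : R) (r : nat) : 0 < k -> (0 < r)%N ->
  \bigcup_n `[k * n.+1%:R^-1 ^+ r, k * n.+1%:R ^+ r]%classic = `]0, +oo[%classic :> set R.
Proof.
move=> k0 r0; apply/seteqP; split => [x [n _] /=|x /=].
  rewrite !in_itv/= andbT => /andP[+ _]; apply: lt_le_trans.
  by rewrite mulr_gt0// exprn_gt0// invr_gt0.
rewrite in_itv/= andbT => x0.
pose y := x / k; have y0 : 0 < y by rewrite divr_gt0.
pose n := Num.bound (y + y^-1).
exists n => //=; rewrite in_itv/=.
have Hn : y + y^-1 < n.+1%:R.
  apply: (@lt_le_trans _ _ (Num.bound (y + y^-1))%:R).
    by rewrite archi_boundP// addr_ge0// ?invr_ge0 ltW.
  by rewrite ler_nat ltnW.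
have yi0 : 0 < y^-1 by rewrite invr_gt0.
have n1 : n.+1%:R <= n.+1%:R ^+ r :> R.
  by rewrite -[leLHS]expr1 ler_weXn2l// ler1n.
have -> : x = k * y by rewrite /y mulrCA divff ?mulr1// gt_eqF.
rewrite !ler_pM2l// exprVn -[y in X in X && _]invrK lef_pV2 ?posrE ?exprn_gt0//.
by apply/andP; split; apply: le_trans n1; apply: ltW; lra.
Qed.

Lemma nondecreasing_monomial_itv (k : R) (r : nat) : 0 < k ->
  nondecreasing_seq
    (fun n => `[k * n.+1%:R^-1 ^+ r, k * n.+1%:R ^+ r]%classic : set R).
Proof.
move=> k0 m n mn; apply/subsetPset => x /=; rewrite !in_itv/= => /andP[ax xb].
have mn' : m.+1%:R <= n.+1%:R :> R by rewrite ler_nat.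
apply/andP; split.
  apply: le_trans ax; rewrite ler_pM2l// lerXn2r ?nnegrE ?invr_ge0//.
  by rewrite lef_pV2 ?posrE.
by apply: (le_trans xb); rewrite ler_pM2l// lerXn2r ?nnegrE.
Qed.

(** Both integrals over the open half-line are exhausted by compact intervals
    away from the origin, where the integrand of [Gamma] is continuous even
    though it may blow up at 0. *)
Lemma gamma_substitution (k s : R) (r : nat) : 0 < k -> (0 < r)%N ->
  (\int[mu]_(x in `]0%R, +oo[) (x `^ (s - 1) * expR (- x))%:E =
   \int[mu]_(t in `]0%R, +oo[)
      ((k * t ^+ r) `^ (s - 1) * expR (- (k * t ^+ r)) * (k * (r%:R * t ^+ r.-1)))%:E)%E.
Proof.
move=> k0 r0; pose F (t : R) := k * t ^+ r; pose G (u : R) := u `^ (s - 1) * expR (- u).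
pose H (t : R) := G (F t) * (k * (r%:R * t ^+ r.-1)).
have F'E : derive1 F = fun t => k * (r%:R * t ^+ r.-1).
  apply/funext => t; rewrite derive1E.
  by apply: derive_val; apply: is_derive_monomial.
have cF : continuous F.
  by move=> t; apply: cvgM; [exact: cvg_cst|exact: exprn_continuous].
have cF' : continuous (derive1 F).
  rewrite F'E => t; apply: cvgM; first exact: cvg_cst.
  by apply: cvgM; [exact: cvg_cst|exact: exprn_continuous].
have cG x : 0 < x -> {for x, continuous G}.
  move=> x0; apply: cvgM; first exact: powR_continuous_pos.
  by apply: continuous_comp; [exact: opp_continuous|exact: continuous_expR].
have F0 t : 0 < t -> 0 < F t by move=> t0; rewrite mulr_gt0// exprn_gt0.
have cH x : 0 < x -> {for x, continuous H}.
  move=> x0; apply: cvgM; last by have := cF' x; rewrite F'E; apply.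
  by apply: (continuous_comp (cF x)); exact/cG/F0.
have mG : measurable_fun (`]0, +oo[ : set R) G.
  apply: open_continuous_measurable_fun; first exact: interval_open.
  by move=> x; rewrite inE/= in_itv/= andbT; exact: cG.
have mH : measurable_fun (`]0, +oo[ : set R) H.
  apply: open_continuous_measurable_fun; first exact: interval_open.
  by move=> x; rewrite inE/= in_itv/= andbT; exact: cH.
have G0 x : 0 <= G x by rewrite mulr_ge0 ?powR_ge0 ?expR_ge0.
have H0 x : 0 < x -> 0 <= H x.
  move=> x0; apply: mulr_ge0; first exact: G0.
  by rewrite mulr_ge0 ?(ltW k0)// mulr_ge0// exprn_ge0// ltW.
pose A n := `[k * n.+1%:R^-1 ^+ r, k * n.+1%:R ^+ r]%classic : set R.
pose B n := `[1 * n.+1%:R^-1 ^+ 1, 1 * n.+1%:R ^+ 1]%classic : set R.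
have AU : \bigcup_n A n = `]0, +oo[%classic by exact: bigcup_monomial_itv.
have BU : \bigcup_n B n = `]0, +oo[%classic by exact: bigcup_monomial_itv.
have AB n : (\int[mu]_(x in A n) (G x)%:E = \int[mu]_(t in B n) (H t)%:E)%E.
  have n1 : n.+1%:R^-1 <= n.+1%:R :> R.
    by rewrite (@le_trans _ _ 1)// ?ler1n// invf_le1// ler1n.
  have n0 : 0 < n.+1%:R^-1 :> R by rewrite invr_gt0.
  rewrite /A /B !mul1r !expr1.
  rewrite (@integration_by_substitution_increasing _ F G)//.
  - by apply: eq_integral => x _; rewrite F'E.
  - move=> x y; rewrite !in_itv/= => /andP[nx _] /andP[ny _] xy.
    rewrite /F ltr_pM2l// ltrXn2r -?lt0n// ?nnegrE//.
    exact: le_trans (ltW n0) nx.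
  - apply/cvg_ex; exists (derive1 F n.+1%:R^-1); apply: cvg_at_right_filter; exact: cF'.
  - apply/cvg_ex; exists (derive1 F n.+1%:R); apply: cvg_at_left_filter; exact: cF'.
  - split.
    + by move=> x _; have [] := is_derive_monomial k r x.
    + by apply: cvg_at_right_filter; exact: cF.
    + by apply: cvg_at_left_filter; exact: cF.
  - apply: continuous_in_subspaceT => x; rewrite inE/= in_itv/= => /andP[Fx _].
    by apply: cG; apply: lt_le_trans Fx; exact: F0.
rewrite -[in LHS]AU -[in RHS]BU.
have limA : (\int[mu]_(x in A n) (G x)%:E @[n --> \oo]
    --> \int[mu]_(x in \bigcup_n A n) (G x)%:E)%E.
  apply: ge0_nondecreasing_set_cvg_integral => //.
  - exact: nondecreasing_monomial_itv.
  - by move=> n; exact: measurable_itv.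
  - move=> n; apply/measurable_EFinP; apply: measurable_funS mG => //.
    by rewrite -AU; exact: bigcup_sup.
  - by move=> n x _; rewrite lee_fin; exact: G0.
have limB : (\int[mu]_(x in B n) (H x)%:E @[n --> \oo]
    --> \int[mu]_(x in \bigcup_n B n) (H x)%:E)%E.
  apply: ge0_nondecreasing_set_cvg_integral => //.
  - exact: nondecreasing_monomial_itv.
  - by move=> n; exact: measurable_itv.
  - move=> n; apply/measurable_EFinP; apply: measurable_funS mH => //.
    by rewrite -BU; exact: bigcup_sup.
  - move=> n x Bx; rewrite lee_fin; apply: H0.
    have : (`]0, +oo[%classic : set R) x by rewrite -BU; exists n.
    by rewrite /= in_itv/= andbT.
move: limA; under eq_fun do rewrite AB; move=> limA.
exact: (cvg_unique _ limA limB).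
Qed.

End gamma_moments.

Section gamma_values.
Context {R : realType}.
Notation mu := (@lebesgue_measure R).

(** The substitution u = k t^r turns the integral of Gamma into a moment. *)
Lemma halfline_moment (k : R) (r j : nat) : 0 < k -> (0 < r)%N ->
  has_integral `]0, +oo[ (fun t => t ^+ j * expR (- (k * t ^+ r)))
    (r%:R^-1 * k `^ (- (j.+1%:R / r%:R)) * Gamma (j.+1%:R / r%:R)).
Proof.
move=> k0 r0; have [v Hv] := has_integral_power_exp j r0 k0.
set s : R := j.+1%:R / r%:R.
have rR : r%:R != 0 :> R by rewrite pnatr_eq0 -lt0n.
suff E : Gamma s = k `^ s * r%:R * v.
  rewrite E powRN [X in has_integral _ _ X](_ : _ = v)//.
  by field; rewrite rR/= gt_eqF// powR_gt0.
have := has_integralE (has_integralZ (k `^ s * r%:R) Hv).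
move=> Ev; rewrite /Gamma /Rintegral (gamma_substitution s k0 r0).
rewrite -[RHS]/(fine (k `^ s * r%:R * v)%:E) -Ev; congr fine.
apply: eq_integral => t; rewrite inE/= in_itv/= andbT => t0; congr (_%:E).
have trn : t ^+ r = t `^ r%:R by rewrite powR_mulrn// ltW.
have trn1 : t ^+ r.-1 = t `^ (r%:R - 1).
  by rewrite -powR_mulrn ?ltW// -subn1 natrB.
have tj : t ^+ j = t `^ (r%:R * (s - 1)) * t `^ (r%:R - 1).
  rewrite -powRD; last by rewrite (gt_eqF t0) implybT.
  rewrite -powR_mulrn ?ltW//; congr (_ `^ _).
  by rewrite /s -natr1; field.
rewrite powRM ?exprn_ge0// ?ltW// trn -powRrM tj trn1 -trn.
have -> : k `^ s = k `^ (s - 1) * k.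
  by rewrite -[X in _ * X]powRr1 ?ltW// -powRD ?(gt_eqF k0) ?implybT// subrK.
ring.
Qed.

Lemma continuous_has_integral_exhaust (f : R -> R) (v : R) :
  continuous f -> (forall x, 0 <= x -> 0 <= f x) -> has_integral `]0, +oo[ f v ->
  exists2 a : nat -> R, (forall n, has_integral `[0, n%:R] f (a n)) & a @ \oo --> v.
Proof.
move=> cf f0 Hv; have fv := has_integralE Hv.
have mf := continuous_measurable_fun cf.
pose a n := \int[mu]_(x in `[0, n%:R]) f x.
have Ha n : has_integral `[0, n%:R] f (a n).
  split => //; apply: continuous_compact_integrable => //.
    exact: segment_compact.
  exact: continuous_subspaceT.
exists a => //.
have U : \bigcup_n (`[0, n%:R]%classic : set R) = `[0, +oo[%classic.
  apply/seteqP; split => [x [n _] /=|x /=]; rewrite !in_itv/= andbT.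
    by case/andP.
  move=> x0; exists (Num.bound x) => //=; rewrite in_itv/= x0 ltW//.
  exact: archi_boundP.
have lim : (\int[mu]_(x in `[0%R, n%:R]) (f x)%:E @[n --> \oo] -->
    \int[mu]_(x in \bigcup_n (`[0%R, n%:R]%classic : set R)) (f x)%:E)%E.
  apply: ge0_nondecreasing_set_cvg_integral => //.
  - move=> m n mn; apply/subsetPset => x /=; rewrite !in_itv/= => /andP[->/= xm].
    by rewrite (le_trans xm)// ler_nat.
  - by move=> n; apply/measurable_EFinP; exact: measurable_funTS.
  - by move=> n x /=; rewrite in_itv/= lee_fin => /andP[? _]; exact: f0.
move: lim; rewrite U -integral_itv_obnd_cbnd; last first.
  by apply/measurable_EFinP; exact: measurable_funTS.
rewrite fv; under eq_fun do rewrite (has_integralE (Ha _)).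
by move/fine_cvg.
Qed.

(** Integration by parts: the derivative of t^(j + 1) exp (- t^2) has integral 0, since this
    function vanishes at 0 and at infinity. *)
Lemma gauss_moment_rec (j : nat) (v w : R) :
  has_integral `]0, +oo[ (fun t => t ^+ j * expR (- (1 * t ^+ 2))) v ->
  has_integral `]0, +oo[ (fun t => t ^+ j.+2 * expR (- (1 * t ^+ 2))) w ->
  w = j.+1%:R / 2 * v.
Proof.
move=> Hv Hw; pose f i (t : R) := t ^+ i * expR (- (1 * t ^+ 2)).
have cf i : continuous (f i) by exact: continuous_power_exp.
have f0 i x : 0 <= x -> 0 <= f i x by move=> x0; rewrite mulr_ge0 ?exprn_ge0 ?expR_ge0.
have [a Ha av] := continuous_has_integral_exhaust (cf j) (f0 j) Hv.
have [b Hb bw] := continuous_has_integral_exhaust (cf j.+2) (f0 j.+2) Hw.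
have dF (x : R) : is_derive x 1 (f j.+1) (j.+1%:R * f j x - 2 * f j.+2 x).
  have d1 : is_derive x 1 (fun t : R => t ^+ j.+1) (j.+1%:R * x ^+ j).
    have := is_derive_monomial 1 j.+1 x; rewrite mul1r.
    by under eq_fun do rewrite mul1r.
  have d2 : is_derive x 1 (fun t : R => - (1 * t ^+ 2)) (- (1 * (2 * x ^+ 1))).
    exact: (is_deriveN (is_derive_monomial 1 2 x)).
  have d3 := is_derive1_comp (is_derive_expR _) d2.
  apply: (is_derive_eq (is_deriveM d1 d3)).
  by rewrite /f /GRing.scale/= !exprS expr0; ring.
have cf12 : continuous (fun x => j.+1%:R * f j x - 2 * f j.+2 x).
  by move=> x; apply: cvgB; apply: cvgM; [exact: cvg_cst|exact: cf|exact: cvg_cst|exact: cf].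
have E n : j.+1%:R * a n.+1 - 2 * b n.+1 = f j.+1 n.+1%:R.
  have := has_integralE (has_integralB (has_integralZ j.+1%:R (Ha n.+1)) (has_integralZ 2 (Hb n.+1))).
  rewrite (@continuous_FTC2 _ _ (f j.+1) 0 n.+1%:R)//.
  - by rewrite -EFinB => -[<-]; rewrite /f expr0n/= mul0r subr0.
  - exact: continuous_subspaceT.
  - split.
    + by move=> x _; have [] := dF x.
    + by apply: cvg_at_right_filter; exact: cf.
    + by apply: cvg_at_left_filter; exact: cf.
  - by move=> x _; rewrite derive1E; apply: derive_val; exact: dF.
have lim0 : f j.+1 n.+1%:R @[n --> \oo] --> (0 : R).
  have [C C0 HC] := expR_dominates_power j.+2 (ltr01 : 0 < 1 :> R).
  have lC : C * n.+1%:R^-1 @[n --> \oo] --> (0 : R).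
    rewrite -[X in _ --> X](mulr0 C); apply: cvgM; first exact: cvg_cst.
    exact: (@cvg_harmonic R).
  apply: (squeeze_cvgr _ (cvg_cst 0) lC); near=> n.
  rewrite f0//= ler_pdivlMr// mulrC mulrA -exprS.
  apply: le_trans (HC n.+1%:R _) => //.
  rewrite ler_wpM2l ?exprn_ge0// ler_expR !mul1r lerN2 expr2.
  by rewrite ler_pMl// ler1n.
have lim1 : j.+1%:R * a n.+1 - 2 * b n.+1 @[n --> \oo] --> j.+1%:R * v - 2 * w.
  apply: cvgB; apply: cvgM; try exact: cvg_cst.
    by move: av; rewrite -cvg_shiftS.
  by move: bw; rewrite -cvg_shiftS.
move: lim1; under eq_fun do rewrite E; move=> lim1.
have H : j.+1%:R * v - 2 * w = 0 by exact: (cvg_unique _ lim1 lim0).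
lra.
Unshelve. all: by end_near. Qed.

(** The double factorials come from the recursion on Gaussian moments, started at the
    Gaussian integral, which is Gamma (1 / 2). *)
Lemma Gamma_half_odd (m : nat) :
  Gamma (m%:R + 1 / 2) = (odd_dfact m)%:R / 2 ^+ m * Num.sqrt pi :> R.
Proof.
have H i : has_integral `]0, +oo[ (fun t : R => t ^+ i * expR (- (1 * t ^+ 2)))
    (2^-1 * Gamma (i.+1%:R / 2)).
  have := @halfline_moment 1 2 i ltr01 isT; rewrite powR1 mulr1; exact.
have E i : Gamma ((i.+3)%:R / 2) = i.+1%:R / 2 * Gamma (i.+1%:R / 2) :> R.
  have HE := gauss_moment_rec (H i) (H i.+2).
  rewrite (_ : Gamma _ = 2 * (2^-1 * Gamma (i.+3%:R / 2))); last by field.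
  by rewrite HE; field.
elim: m => [|m IH].
  rewrite /odd_dfact big_ord0 expr0 divr1 add0r.
  have := has_integralE (H 0%N); rewrite integral_itv_obnd_cbnd; last first.
    have mE := continuous_measurable_fun (@continuous_power_exp R 0 2 1).
    by apply/measurable_EFinP; exact: measurable_funTS.
  under eq_integral do rewrite expr0 !mul1r.
  by rewrite (integral0y_gauss (R := R)) => -[]; lra.
have -> : m.+1%:R + 1 / 2 = (2 * m).+3%:R / 2 :> R.
  by rewrite -!natr1 natrM; field.
rewrite E (_ : (2 * m).+1%:R / 2 = m%:R + 1 / 2); last by rewrite -[(2 * m).+1%:R]natr1 natrM; field.
have -> : odd_dfact m.+1 = (odd_dfact m * m.*2.+1)%N by rewrite /odd_dfact big_ord_recr.
rewrite IH natrM exprS -[m.*2.+1%:R]natr1 -muln2 natrM.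
by field; rewrite expf_neq0.
Qed.

Lemma continuous_normX (r : nat) : continuous (fun t : R => `|t| ^+ r).
Proof.
move=> x; apply: (@continuous_comp R R R (fun t => `|t|) (fun t => t ^+ r)).
  exact: norm_continuous.
exact: exprn_continuous.
Qed.

Lemma continuous_mul_exp_normX (k : R) (r : nat) (g : R -> R) : continuous g ->
  continuous (fun t : R => g t * expR (- (k * `|t| ^+ r))).
Proof.
move=> cg x; apply: cvgM; first exact: cg.
apply: continuous_comp; last exact: continuous_expR.
by apply: cvgN; apply: cvgM; [exact: cvg_cst|exact: continuous_normX].
Qed.

(** With |t|^r rather than t^r the integrand has the parity of j for every r, including
    r = 1, the exponential bound used for the tails. *)
Lemma even_moment (k : R) (r j : nat) : 0 < k -> (0 < r)%N -> ~~ odd j ->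
  has_integral setT (fun t => t ^+ j * expR (- (k * `|t| ^+ r)))
    (2 / r%:R * k `^ (- (j.+1%:R / r%:R)) * Gamma (j.+1%:R / r%:R)).
Proof.
move=> k0 r0 jeven.
rewrite (_ : 2 / _ * _ * _ =
    2 * (r%:R^-1 * k `^ (- (j.+1%:R / r%:R)) * Gamma (j.+1%:R / r%:R))); last first.
  by rewrite !mulrA.
apply: even_has_integral.
- by apply: continuous_mul_exp_normX => x; exact: exprn_continuous.
- by move=> x; rewrite mulr_ge0 ?expR_ge0// exprn_even_ge0.
- by move=> x; rewrite normrN exprNn -signr_odd (negbTE jeven) mul1r.
- apply: eq_has_integral (halfline_moment j k0 r0) => t.
  by rewrite inE/= in_itv/= andbT => t0; rewrite gtr0_norm.
Qed.

Lemma odd_moment (k : R) (r j : nat) : 0 < k -> (0 < r)%N -> odd j ->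
  has_integral setT (fun t => t ^+ j * expR (- (k * `|t| ^+ r))) 0.
Proof.
move=> k0 r0 jodd.
have [v Hv] := has_integral_power_exp j r0 k0.
apply: (@odd_has_integral _ _ (fun t => `|t| ^+ j * expR (- (k * `|t| ^+ r))) (2 * v)).
- by apply: continuous_mul_exp_normX => x; exact: exprn_continuous.
- by move=> x; rewrite normrN exprNn -signr_odd jodd expr1 mulN1r mulNr.
- by move=> x; rewrite normrM normrX [X in _ * X]ger0_norm// expR_ge0.
- apply: even_has_integral.
  + by apply: continuous_mul_exp_normX; exact: continuous_normX.
  + by move=> x; rewrite mulr_ge0 ?expR_ge0// exprn_ge0.
  + by move=> x; rewrite normrN.
  + apply: eq_has_integral Hv => t.
    by rewrite inE/= in_itv/= andbT => t0; rewrite gtr0_norm.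
Qed.

End gamma_values.

(** * Composition sums as coefficients *)

Section compositions.
Context {R : realType}.
Implicit Types (b : nat -> R) (p q : {poly R}).

Lemma coef_exp_eq p q (N k : nat) : (forall i, (i <= N)%N -> p`_i = q`_i) ->
  forall i, (i <= N)%N -> (p ^+ k)`_i = (q ^+ k)`_i.
Proof.
move=> pq; elim: k => [|k IH] i iN; first by rewrite !expr0.
rewrite !exprS !coefM; apply: eq_bigr => j _.
rewrite pq ?IH//; first by rewrite (leq_trans (leq_subr _ _)).
by rewrite (leq_trans _ iN)// -ltnS.
Qed.

(** The generating function of composition sums: both sides expand a product of
    [k] power series without constant term, and only the terms of degree at
    most [N] matter. *)
Lemma composition_sum_coef b (k N P : nat) : (N <= P)%N ->
  composition_sum b k N = ((\sum_(1 <= m < P.+1) b m *: 'X^m) ^+ k)`_N.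
Proof.
move=> NP.
have cB Q i : (i <= Q)%N ->
    (\sum_(1 <= m < Q.+1) b m *: 'X^m)`_i = if (0 < i)%N then b i else 0.
  move=> iQ; rewrite coef_sum.
  under eq_bigr do rewrite coefZ coefXn.
  case: ifPn => [i0|]; last first.
    rewrite -leqNgt leqn0 => /eqP->; rewrite big_nat big1// => m /andP[m0 _].
    by rewrite eq_sym gtn_eqF// mulr0.
  rewrite (bigD1_seq i)/= ?iota_uniq ?mem_index_iota ?i0// eqxx mulr1.
  by rewrite big1 ?addr0// => m /negbTE; rewrite eq_sym => ->; rewrite mulr0.
rewrite (@coef_exp_eq _ (\sum_(m < N.+1) (if (0 < m)%N then b m else 0) *: 'X^m) N); last 2 first.
- move=> i iN; rewrite cB ?(leq_trans iN)// coef_sum.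
  under eq_bigr do rewrite coefZ coefXn.
  rewrite (bigD1 (Ordinal (iN : (i < N.+1)%N)))//= eqxx mulr1.
  rewrite big1 ?addr0// => m; rewrite -val_eqE/= => /negbTE; rewrite eq_sym => ->.
  by rewrite mulr0.
- by [].
rewrite -[in RHS](card_ord k) -prodr_const bigA_distr_bigA coef_sum.
rewrite /composition_sum big_mkcond/=; apply: eq_bigr => f _.
have -> : \prod_(i : 'I_k) ((if (0 < f i)%N then b (f i) else 0) *: 'X^(f i)) =
    (\prod_(i : 'I_k) (if (0 < f i)%N then b (f i) else 0)) *: 'X^(\sum_i f i) :> {poly R}.
  by rewrite scaler_prod; congr (_ *: _); rewrite expr_sum.
rewrite coefZ coefXn eq_sym.
have [/forallP fpos|] := boolP [forall i, (0 < f i)%N].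
  have -> : \prod_(i : 'I_k) (if (0 < f i)%N then b (f i) else 0) = \prod_i b (f i).
    by apply: eq_bigr => i _; rewrite fpos.
  by case: eqP => _; rewrite ?mulr1 ?mulr0.
rewrite negb_forall => /existsP[i fi0] /=.
by rewrite (bigD1 i)//= (negbTE fi0) !mul0r.
Qed.

Lemma composition_sum_gt b (k N : nat) : (N < k)%N -> composition_sum b k N = 0.
Proof.
move=> Nk; rewrite /composition_sum big_pred0// => f; apply/negP.
move=> /andP[/forallP fpos /eqP fN].
have : (k <= \sum_(i < k) f i)%N.
  rewrite -[leqLHS]card_ord -sum1_card; apply: leq_sum => i _; exact: fpos.
by rewrite fN leqNgt Nk.
Qed.

Lemma composition_sum0 b (N : nat) : composition_sum b 0 N = (N == 0)%:R.
Proof.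
by rewrite (composition_sum_coef b 0 (leqnn N)) expr0 coef1.
Qed.

Lemma composition_sum_pos0 b (N : nat) : (0 < N)%N -> composition_sum b 0 N = 0.
Proof. by move=> N0; rewrite composition_sum0 gtn_eqF. Qed.

End compositions.

(** * Taylor bounds *)

Section taylor.
Context {R : realType}.
Implicit Types (f df : R -> R) (x t : R).

Lemma mean_value f df (t x : R) : (forall y : R, is_derive y 1 f (df y)) ->
  exists2 y, `|y - t| <= `|x - t| & f x - f t = df y * (x - t).
Proof.
move=> fdf; have cf a b' : {within `[a, b'], continuous f}.
  apply: continuous_subspaceT => y; apply: differentiable_continuous.
  by apply/derivable1_diffP; have [] := fdf y.
have [tx|xt] := leP t x.
  have [y + E] := MVT_segment tx (fun y _ => fdf y) (cf _ _).
  rewrite in_itv/= => /andP[ty yx]; exists y => //.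
  by rewrite !ger0_norm ?subr_ge0// lerB.
have [y + E] := MVT_segment (ltW xt) (fun y _ => fdf y) (cf _ _).
rewrite in_itv/= => /andP[xy yt]; exists y.
  by rewrite !ler0_norm ?subr_le0 ?(ltW xt)// !opprB lerB.
by rewrite -[LHS]opprB E -mulrN opprB.
Qed.

(** By induction on n: the remainder of F 0 vanishes at t and its derivative is the
    remainder of F 1, so the mean value theorem gains one power. *)
Lemma taylor_bound (F : nat -> R -> R) (t K rho : R) (n : nat) :
  (forall j (x : R), is_derive x 1 (F j) (F j.+1 x)) ->
  (forall x, `|x - t| <= rho -> `|F n x| <= K) ->
  forall x, `|x - t| <= rho ->
  `|F 0%N x - \sum_(j < n) F j t / j`!%:R * (x - t) ^+ j| <= K * `|x - t| ^+ n.
Proof.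
elim: n F => [|n IH] F dF FK x xt.
  by rewrite big_ord0 subr0 expr0 mulr1 FK.
pose D y := F 0%N y - \sum_(j < n.+1) F j t / j`!%:R * (y - t) ^+ j.
pose D' y := F 1%N y - \sum_(j < n) F j.+1 t / j`!%:R * (y - t) ^+ j.
have dD (y : R) : is_derive y 1 D (D' y).
  have -> : D = F 0%N - \sum_(j < n.+1) (fun y => F j t / j`!%:R * (y - t) ^+ j).
    by apply/funext => z; rewrite /D !fctE fct_sumE.
  have dj (j : nat) : is_derive y 1 (fun y => F j t / j`!%:R * (y - t) ^+ j)
      (F j t / j`!%:R * (j%:R * (y - t) ^+ j.-1)).
    apply: is_deriveZ.
    have d1 : is_derive y 1 (fun y => y - t) (1 - 0).
      exact: (is_deriveB (is_derive_id _ _) (is_derive_cst _ _ _)).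
    have := is_deriveX j d1; rewrite exprfctE subr0 /GRing.scale/= mulr1; exact.
  have dS := is_derive_sum (fun j : 'I_n.+1 => dj j).
  apply: (is_derive_eq (is_deriveB (dF 0%N y) dS)); congr (_ - _).
  rewrite big_ord_recl/= mul0r mulr0 add0r; apply: eq_bigr => j _.
  rewrite /bump/= add1n factS natrM.
  have f0 : j`!%:R != 0 :> R by rewrite pnatr_eq0 -lt0n fact_gt0.
  have j0 : j.+1%:R != 0 :> R by rewrite pnatr_eq0.
  by field; rewrite f0 addrC natr1.
have [y yt E] := mean_value t x dD.
have Dt : D t = 0.
  rewrite /D big_ord_recl/= expr0 mulr1 divr1 big1 ?addr0 ?subrr// => j _.
  by rewrite ?subrr expr0n/= mulr0.
move: E; rewrite Dt subr0 -/(D x) => ->.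
rewrite normrM exprSr mulrA ler_wpM2r//.
apply: (@le_trans _ _ (K * `|y - t| ^+ n)); last first.
  rewrite ler_wpM2l ?lerXn2r ?nnegrE//.
  by apply: le_trans (FK t _); rewrite ?subrr ?normr0 ?(le_trans _ xt).
apply: (IH (fun j => F j.+1)) => //; exact: (le_trans yt).
Qed.

Lemma expR_taylor_bound (n : nat) (x : R) :
  `|expR x - \sum_(j < n) x ^+ j / j`!%:R| <= `|x| ^+ n * expR `|x|.
Proof.
have dE (j : nat) (y : R) : is_derive y 1 (@expR R) (expR y) by exact: is_derive_expR.
have := @taylor_bound (fun=> @expR R) 0 (expR `|x|) `|x| n dE.
have H y : `|y - 0| <= `|x| -> `|expR y| <= expR `|x|.
  rewrite subr0 => yx; rewrite ger0_norm ?expR_ge0// ler_expR.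
  exact: le_trans (ler_norm _) yx.
move=> /(_ H x); rewrite subr0 => /(_ (lexx _)); rewrite mulrC.
by under eq_bigr do rewrite expR0 mulrC mulrA mulr1.
Qed.

End taylor.

(** * Pointwise domination and the local expansion *)

(** A bound up to a multiplicative constant that is uniform on X; here X will be a set of
    pairs (n, t), so that the constants do not depend on n. *)
Definition dominated {R : realType} {T : Type} (X : T -> Prop) (f h : T -> R) : Prop :=
  exists2 C, 0 <= C & forall p, X p -> `|f p| <= C * h p.

Section dominated_theory.
Context {R : realType} {T : Type}.
Implicit Types (X : T -> Prop) (f g h : T -> R).

Lemma eq_dominated X f g h : (forall p, X p -> f p = g p) ->
  dominated X f h -> dominated X g h.
Proof.
by move=> fg [C C0 H]; exists C => // p Xp; rewrite -fg// H.
Qed.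

Lemma dominatedD X f g h : dominated X f h -> dominated X g h ->
  dominated X (fun p => f p + g p) h.
Proof.
move=> [C C0 Hf] [D D0 Hg]; exists (C + D); first exact: addr_ge0.
move=> p Xp; rewrite mulrDl; apply: le_trans (ler_normD _ _) _.
by rewrite lerD// ?Hf ?Hg.
Qed.

Lemma dominated_sum (I : Type) (s : seq I) X h (f : I -> T -> R) :
  (forall i, dominated X (f i) h) -> dominated X (fun p => \sum_(i <- s) f i p) h.
Proof.
move=> H; elim: s => [|i s IH].
  by exists 0 => // p Xp; rewrite big_nil normr0 mul0r.
by apply: eq_dominated (dominatedD (H i) IH) => p Xp; rewrite big_cons.
Qed.

Lemma dominatedZ X f h (k : R) : dominated X f h -> dominated X (fun p => k * f p) h.
Proof.
move=> [C C0 H]; exists (`|k| * C); first exact: mulr_ge0.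
by move=> p Xp; rewrite normrM -mulrA ler_wpM2l// H.
Qed.

Lemma dominatedM X f g h k : dominated X f h -> dominated X g k ->
  dominated X (fun p => f p * g p) (fun p => h p * k p).
Proof.
move=> [C C0 Hf] [D D0 Hg]; exists (C * D); first exact: mulr_ge0.
move=> p Xp; rewrite normrM mulrACA.
by apply: ler_pM => //; [exact: Hf|exact: Hg].
Qed.

Lemma le_dominated X f h : (forall p, X p -> `|f p| <= h p) -> dominated X f h.
Proof. by move=> H; exists 1 => // p Xp; rewrite mul1r H. Qed.

Lemma dominated_damp X f g h : (forall p, X p -> 0 <= g p <= 1) ->
  dominated X f h -> dominated X (fun p => g p * f p) h.
Proof.
move=> Hg [C C0 H]; exists C => // p Xp; have /andP[g0 g1] := Hg p Xp.
by apply: le_trans (H p Xp); rewrite normrM ger0_norm// ler_piMl.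
Qed.

Lemma dominated_trans X f g h : dominated X f g -> dominated X g h -> dominated X f h.
Proof.
move=> [C C0 Hf] [D D0 Hg]; exists (C * D); first exact: mulr_ge0.
move=> p Xp; apply: (le_trans (Hf p Xp)); rewrite -mulrA ler_wpM2l//.
by apply: le_trans (ler_norm _) _; exact: Hg.
Qed.

End dominated_theory.

Section pointwise.
Context {R : realType}.

Lemma exprn_lipschitz (M : R) (k : nat) : 0 <= M ->
  exists2 C, 0 <= C &
    forall u v, `|u| <= M -> `|v| <= M -> `|v ^+ k - u ^+ k| <= C * `|v - u|.
Proof.
move=> M0; elim: k => [|k [C C0 IH]].
  by exists 0 => // u v _ _; rewrite !expr0 subrr normr0 mul0r.
exists (M * C + M ^+ k); first by rewrite addr_ge0 ?mulr_ge0 ?exprn_ge0.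
move=> u v uM vM.
have -> : v ^+ k.+1 - u ^+ k.+1 = v * (v ^+ k - u ^+ k) + (v - u) * u ^+ k.
  by rewrite !exprS; ring.
apply: le_trans (ler_normD _ _) _; rewrite [leRHS]mulrDl !normrM.
apply: lerD; first by rewrite -mulrA ler_pM// IH.
by rewrite mulrC ler_wpM2r// normrX lerXn2r ?nnegrE.
Qed.

Lemma horner_truncation (p : {poly R}) (n : nat) :
  exists2 C, 0 <= C & forall y, `|y| <= 1 ->
    `|p.[y] - \sum_(i < n) p`_i * y ^+ i| <= C * `|y| ^+ n.
Proof.
exists (\sum_(n <= i < n + size p) `|p`_i|).
  by apply: sumr_ge0.
move=> y y1; rewrite (@horner_coef_wide _ (n + size p)%N) ?leq_addl//.
rewrite -(big_mkord xpredT (fun i => p`_i * y ^+ i)).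
rewrite (@big_cat_nat _ _ _ n)//= ?leq_addr// big_mkord.
rewrite [X in `|X|]addrAC subrr add0r.
apply: le_trans (ler_norm_sum _ _ _) _; rewrite mulr_suml.
rewrite big_nat [leRHS]big_nat; apply: ler_sum => i /andP[ni _].
by rewrite normrM ler_wpM2l// normrX ler_wiXn2l.
Qed.

(** Half of the exponential absorbs any power. *)
Lemma power_absorb (k : nat) (a : R) : 0 < a ->
  exists2 D, 0 <= D & forall w, 0 <= w ->
    w ^+ k * expR (- (2 * a * w)) <= D * expR (- (a * w)).
Proof.
move=> a0; have [C C0 H] := expR_dominates_power k a0; exists C; first exact: ltW.
move=> w w0; have -> : - (2 * a * w) = - (a * w) + - (a * w) by ring.
by rewrite expRD mulrA ler_wpM2r ?expR_ge0// H.
Qed.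

Variables (r s P : nat) (b : nat -> R) (c : R).
Hypotheses (s0 : (0 < s)%N) (c0 : 0 < c).

(** The expansion of exp (x |t|^r sum_m b_m t^(s m)) in powers of t with
    w = x |t|^r kept as an independent variable. *)
Definition laplace_poly (x t : R) : R :=
  \sum_(N < P.+1) t ^+ (s * N) *
    \sum_(k < P.+1) composition_sum b k N / k`!%:R * (x * `|t| ^+ r) ^+ k.

(** Every neglected term is of this size: one more power of t^s, at the price of
    weakening the exponential from c to c / 4. *)
Definition laplace_error (p : R * R) : R :=
  `|p.2| ^+ (s * P.+1) * expR (- (c / 4 * (p.1 * `|p.2| ^+ r))).

Let w (p : R * R) := p.1 * `|p.2| ^+ r.

(** Powers of w = x |t|^r cost a part of the exponential and nothing else. *)
Lemma dominated_power_exp X (f : R * R -> R) (k : nat) :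
  (forall p, X p -> 0 <= p.1) ->
  dominated X f (fun p => `|p.2| ^+ (s * P.+1)) ->
  dominated X (fun p => f p * (w p ^+ k * expR (- (c / 2 * w p)))) laplace_error.
Proof.
move=> X0 Hf.
have c4 : 0 < c / 4 by rewrite divr_gt0.
have [D D0 HD] := power_absorb k c4.
apply: dominatedM Hf _; exists D => // p Xp.
have w0 : 0 <= w p by rewrite mulr_ge0 ?X0// exprn_ge0.
rewrite ger0_norm ?mulr_ge0 ?exprn_ge0 ?expR_ge0//.
by have := HD _ w0; rewrite (_ : 2 * (c / 4) = c / 2); last by field.
Qed.

(** Where |t| >= del, lower powers of |t| are at most a constant times the power s (P + 1). *)
Lemma laplace_poly_tail (del : R) : 0 < del ->
  dominated (fun p => 0 <= p.1 /\ del <= `|p.2|)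
    (fun p => laplace_poly p.1 p.2 * expR (- (c * w p))) laplace_error.
Proof.
move=> del0; set X := fun p => _.
have X0 p : X p -> 0 <= p.1 by case.
apply: (@eq_dominated _ _ _ (fun p => \sum_(N < P.+1) \sum_(k < P.+1)
   (composition_sum b k N / k`!%:R) * (p.2 ^+ (s * N) * expR (- (c / 2 * w p)) *
     (w p ^+ k * expR (- (c / 2 * w p)))))).
  move=> p _; rewrite /laplace_poly mulr_suml; apply: eq_bigr => N _.
  rewrite mulr_sumr mulr_suml; apply: eq_bigr => k _.
  have -> : expR (- (c * w p)) = expR (- (c / 2 * w p)) * expR (- (c / 2 * w p)).
    by rewrite -expRD; congr expR; field.
  by rewrite -/(w p); ring.
apply: dominated_sum => N; apply: dominated_sum => k; apply: dominatedZ.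
apply: dominated_power_exp => //.
exists (del^-1 ^+ (s * P.+1 - s * N)); first by rewrite exprn_ge0// invr_ge0 ltW.
move=> p [p0 tp]; rewrite normrM normrX [X in _ * X]ger0_norm ?expR_ge0//.
have e1 : expR (- (c / 2 * w p)) <= 1.
  by rewrite expR_le1 oppr_le0 !mulr_ge0 ?exprn_ge0// ?ltW// divr_gt0.
apply: (@le_trans _ _ (`|p.2| ^+ (s * N))); first by rewrite ler_piMr ?exprn_ge0.
have sNP : (s * N <= s * P.+1)%N by rewrite leq_mul2l ltnW ?orbT// ltn_ord.
rewrite -[X in _ * _ ^+ X](subnK sNP) exprD mulrA -exprMn ler_peMl ?exprn_ge0//.
by rewrite exprn_ege1// mulrC ler_pdivlMr// mul1r.
Qed.

Variables (g : R -> R) (del C1 : R).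
Hypotheses (del0 : 0 < del)
  (Hg : forall t, `|t| <= del ->
    `|g t + c * `|t| ^+ r - `|t| ^+ r * \sum_(1 <= m < P.+1) b m * t ^+ (s * m)|
      <= C1 * `|t| ^+ (r + s * P.+1)).

Let B : {poly R} := \sum_(1 <= m < P.+1) b m *: 'X^m.

Let B_horner y : B.[y] = \sum_(1 <= m < P.+1) b m * y ^+ m.
Proof.
by rewrite /B horner_sum; apply: eq_bigr => m _; rewrite hornerZ hornerXn.
Qed.

Let B_bound y : `|y| <= 1 -> `|B.[y]| <= (\sum_(1 <= m < P.+1) `|b m|) * `|y|.
Proof.
move=> y1; rewrite B_horner; apply: le_trans (ler_norm_sum _ _ _) _.
rewrite mulr_suml big_nat [leRHS]big_nat; apply: ler_sum => m /andP[m0 _].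
by rewrite normrM ler_wpM2l// normrX -[leRHS]expr1 ler_wiXn2l.
Qed.

(** After factoring out |t|^r, the exponent is x |t|^r v with v close to the
    polynomial B(t^s) and small near 0, so that the exponential series in
    x |t|^r v can be cut at order P. *)
Lemma laplace_local : exists del', [/\ 0 < del', del' <= del &
  dominated (fun p => 0 <= p.1 /\ `|p.2| <= del')
    (fun p => expR (p.1 * g p.2) - laplace_poly p.1 p.2 * expR (- (c * w p)))
    laplace_error].
Proof.
have c2 : 0 <= c / 2 by rewrite ltW// divr_gt0.
pose Cu := \sum_(1 <= m < P.+1) `|b m|.
have Cu0 : 0 <= Cu by apply: sumr_ge0.
pose C2 := Cu + `|C1| + 1.
have C20 : 0 < C2 by rewrite ltr_wpDl// addr_ge0.
pose del' := Num.min (Num.min del 1) (c / (2 * C2)).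
have del'0 : 0 < del' by rewrite !lt_min del0 ltr01 divr_gt0// mulr_gt0.
have del'1 : del' <= 1 by rewrite !ge_min lexx orbT.
have del'd : del' <= del by rewrite !ge_min lexx.
have del'c : C2 * del' <= c / 2.
  apply: (@le_trans _ _ (C2 * (c / (2 * C2)))).
    by rewrite ler_wpM2l ?(ltW C20)// ge_min lexx orbT.
  by rewrite le_eqVlt; apply/orP; left; apply/eqP; field; rewrite gt_eqF.
exists del'; split => //.
(* At t = 0 the quotient is meaningless; the value of B satisfies the bounds below. *)
pose v t := if `|t| ^+ r == 0 then B.[t ^+ s] else (g t + c * `|t| ^+ r) / `|t| ^+ r.
have gv t : `|t| <= del' -> g t = `|t| ^+ r * v t - c * `|t| ^+ r.
  move=> td; rewrite /v; case: eqP => [tr|/eqP tr].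
    have := Hg (le_trans td del'd).
    rewrite exprD tr !(mul0r, mulr0) subr0 addr0 normr_le0 => /eqP ->.
    by rewrite subr0.
  by rewrite mulrCA divff// mulr1 addrK.
have vB t : `|t| <= del' -> `|v t - B.[t ^+ s]| <= `|C1| * `|t| ^+ (s * P.+1).
  move=> td; rewrite /v; case: eqP => [tr|/eqP tr].
    by rewrite subrr normr0 mulr_ge0// exprn_ge0.
  have tr0 : 0 < `|t| ^+ r by rewrite lt_neqAle eq_sym tr exprn_ge0.
  have -> : (g t + c * `|t| ^+ r) / `|t| ^+ r - B.[t ^+ s] =
    (g t + c * `|t| ^+ r - `|t| ^+ r * B.[t ^+ s]) / `|t| ^+ r by field.
  rewrite normrM normfV (gtr0_norm tr0) ler_pdivrMr//.
  rewrite B_horner; under eq_bigr do rewrite -exprM.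
  apply: le_trans (Hg (le_trans td del'd)) _.
  by rewrite exprD [_ ^+ r * _]mulrC mulrA ler_wpM2r ?(ltW tr0)// ler_wpM2r ?exprn_ge0// ler_norm.
have ts t : `|t| <= del' -> `|t ^+ s| <= `|t|.
  move=> td; rewrite normrX -[leRHS]expr1 ler_wiXn2l//; exact: le_trans td _.
have ts1 t : `|t| <= del' -> `|t ^+ s| <= 1.
  by move=> td; rewrite (le_trans (ts _ td))// (le_trans td).
have Bts t : `|t| <= del' -> `|B.[t ^+ s]| <= Cu * `|t ^+ s|.
  by move=> td; apply: B_bound; exact: ts1.
have vt t : `|t| <= del' -> `|v t| <= C2 * `|t ^+ s|.
  move=> td; have -> : v t = (v t - B.[t ^+ s]) + B.[t ^+ s] by rewrite subrK.
  apply: le_trans (ler_normD _ _) _.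
  apply: (@le_trans _ _ (`|C1| * `|t ^+ s| + Cu * `|t ^+ s|)).
    apply: lerD; last exact: Bts.
    apply: (le_trans (vB _ td)); rewrite ler_wpM2l// exprM -normrX.
    by rewrite -[leRHS]expr1 ler_wiXn2l// ts1.
  by rewrite -mulrDl ler_wpM2r// /C2; lra.
have small (C : R) t : 0 <= C -> C <= C2 -> `|t| <= del' -> C * `|t ^+ s| <= c / 2.
  move=> C0 CC td; apply: le_trans del'c; apply: ler_pM => //.
  by rewrite (le_trans (ts _ td)).
have vc t : `|t| <= del' -> `|v t| <= c / 2.
  by move=> td; rewrite (le_trans (vt _ td))// small// ltW.
have Bc t : `|t| <= del' -> `|B.[t ^+ s]| <= c / 2.
  by move=> td; rewrite (le_trans (Bts _ td))// small// /C2; have := normr_ge0 C1; lra.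
set X := fun p => _.
have X0 p : X p -> 0 <= p.1 by case.
have w0 p : X p -> 0 <= w p by move=> [p0 _]; rewrite mulr_ge0// exprn_ge0.
pose S (y : R) (k : nat) := \sum_(N < P.+1) composition_sum b k N * y ^+ N.
have expsplit p : expR (- (c * w p)) = expR (- (c / 2 * w p)) * expR (- (c / 2 * w p)).
  by rewrite -expRD; congr expR; field.
(* The error splits into the tail of the exponential series, the replacement of v by
   B, and the truncation of the powers of B. *)
apply: (@eq_dominated _ _ _ (fun p =>
   expR (- (c * w p)) * (expR (w p * v p.2) - \sum_(k < P.+1) (w p * v p.2) ^+ k / k`!%:R) +
   \sum_(k < P.+1) k`!%:R^-1 * (expR (- (c / 2 * w p)) * ((v p.2 ^+ k - B.[p.2 ^+ s] ^+ k) +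
      (B.[p.2 ^+ s] ^+ k - S (p.2 ^+ s) k)) * (w p ^+ k * expR (- (c / 2 * w p)))))).
  move=> p [p0 td].
  have -> : expR (p.1 * g p.2) = expR (- (c * w p)) * expR (w p * v p.2).
    by rewrite -expRD gv//; congr expR; rewrite /w; ring.
  have -> : laplace_poly p.1 p.2 = \sum_(k < P.+1) k`!%:R^-1 * S (p.2 ^+ s) k * w p ^+ k.
    rewrite /laplace_poly; under eq_bigr do rewrite mulr_sumr.
    rewrite exchange_big/=; apply: eq_bigr => k _.
    rewrite /S mulr_sumr mulr_suml; apply: eq_bigr => N _.
    by rewrite exprM /w; ring.
  rewrite mulrBr -addrA; congr (_ + _).
  rewrite mulr_sumr mulr_suml -!sumrN -big_split/=; apply: eq_bigr => k _.
  by rewrite exprMn expsplit; ring.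
apply: dominatedD.
  apply: (@dominated_trans _ _ _ _ (fun p => (`|p.2| ^+ (s * P.+1)) *
     (w p ^+ P.+1 * expR (- (c / 2 * w p))))); last first.
    apply: dominated_power_exp => //; apply: le_dominated => p _.
    by rewrite ger0_norm// exprn_ge0.
  exists (C2 ^+ P.+1); first by rewrite exprn_ge0 ?ltW.
  move=> p Xp; have [p0 td] := Xp; have wp := w0 p Xp.
  rewrite normrM ger0_norm ?expR_ge0//.
  have Ev : `|w p * v p.2| <= c / 2 * w p.
    by rewrite normrM ger0_norm// mulrC ler_wpM2r// vc.
  have := expR_taylor_bound P.+1 (w p * v p.2).
  move=> /(ler_wpM2l (expR_ge0 (- (c * w p)))) /le_trans; apply.
  apply: (@le_trans _ _ (expR (- (c * w p)) *
     ((C2 * `|p.2 ^+ s| * w p) ^+ P.+1 * expR (c / 2 * w p)))).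
    rewrite ler_wpM2l ?expR_ge0// ler_pM ?exprn_ge0 ?expR_ge0// ?ler_expR//.
    rewrite lerXn2r ?nnegrE ?mulr_ge0// ?(ltW C20)//.
    by rewrite normrM ger0_norm// mulrC ler_wpM2r// vt.
  rewrite expsplit !exprMn normrX -exprM.
  have -> : expR (c / 2 * w p) = (expR (- (c / 2 * w p)))^-1 by rewrite expRN invrK.
  rewrite le_eqVlt; apply/orP; left; apply/eqP; field.
  by rewrite gt_eqF// expR_gt0.
apply: dominated_sum => k; apply: dominatedZ; apply: dominated_power_exp => //.
apply: dominated_damp => [p Xp|].
  by rewrite expR_ge0/= expR_le1 oppr_le0 mulr_ge0 ?w0.
apply: dominatedD.
  have [C Cge0 HC] := exprn_lipschitz k c2.
  exists (C * `|C1|); first exact: mulr_ge0.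
  move=> p [_ td]; apply: (le_trans (HC _ _ (Bc _ td) (vc _ td))).
  by rewrite -mulrA ler_wpM2l// vB.
have [C Cge0 HC] := horner_truncation (B ^+ k) P.+1; exists C => // p [_ td].
rewrite exprM -normrX -horner_exp; apply: le_trans (HC _ (ts1 _ td)).
rewrite le_eqVlt; apply/orP; left; apply/eqP; congr (`|_ - _|).
rewrite /S; apply: eq_bigr => N _.
by rewrite (@composition_sum_coef _ _ _ _ P)// -ltnS.
Qed.

End pointwise.

(** * Laplace's method *)

Section laplace.
Context {R : realType}.

(** The coefficient of n^(-(s N + 1) / r). Substituting t = n^(-1 / r) y, the term
    t^(s N) (n |t|^r)^k exp (- c n |t|^r) contributes this power of n times the moment of order
    s N + r k of exp (- c |y|^r), which vanishes when s N is odd. *)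
Definition laplace_coef (r s : nat) (b : nat -> R) (c : R) (N : nat) : R :=
  if odd (s * N) then 0 else
  \sum_(0 <= k < N.+1) composition_sum b k N / k`!%:R *
    (2 / r%:R * c `^ (- ((s * N).+1%:R / r%:R + k%:R))
     * Gamma ((s * N).+1%:R / r%:R + k%:R)).

Lemma has_integral_laplace_poly (r s P : nat) (b : nat -> R) (c x : R) :
  (0 < r)%N -> ~~ odd r -> 0 < c -> 0 < x ->
  has_integral setT
    (fun t => laplace_poly r s P b x t * expR (- (c * (x * `|t| ^+ r))))
    (\sum_(N < P.+1) laplace_coef r s b c N * x `^ (- ((s * N).+1%:R / r%:R))).
Proof.
move=> r0 reven c0 x0; have xc0 : 0 < c * x by rewrite mulr_gt0.
pose F (N : 'I_P.+1) (k : 'I_P.+1) (t : R) := composition_sum b k N / k`!%:R * x ^+ k *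
  (t ^+ (s * N + r * k) * expR (- (c * x * `|t| ^+ r))).
apply: (@eq_has_integral _ _ (fun t => \sum_N \sum_k F N k t)).
  move=> t _; rewrite /laplace_poly mulr_suml; apply: eq_bigr => N _.
  rewrite mulr_sumr mulr_suml; apply: eq_bigr => k _; rewrite /F.
  have -> : `|t| ^+ r = t ^+ r.
    by rewrite -normrX ger0_norm// exprn_even_ge0.
  by rewrite exprMn exprD [t ^+ (r * k)]exprM -(mulrA c x (t ^+ r)); ring.
apply: has_integral_sum => // N _; rewrite /laplace_coef.
have odd_rk k : odd (s * N + r * k) = odd (s * N).
  by rewrite oddD [odd (r * k)]oddM (negbTE reven) addbF.
case: ifPn => [sNodd|sNeven].
  rewrite mul0r [X in has_integral _ _ X](_ : 0 = \sum_(k < P.+1) (0 : R)); last by rewrite big1.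
  apply: has_integral_sum => // k _; rewrite -(mulr0 (composition_sum b k N / k`!%:R * x ^+ k)).
  by apply: has_integralZ; apply: odd_moment => //; rewrite odd_rk.
have -> : (\sum_(0 <= k < N.+1) composition_sum b k N / k`!%:R *
    (2 / r%:R * c `^ (- ((s * N).+1%:R / r%:R + k%:R)) *
     Gamma ((s * N).+1%:R / r%:R + k%:R))) * x `^ (- ((s * N).+1%:R / r%:R)) =
  \sum_(k < P.+1) composition_sum b k N / k`!%:R * x ^+ k *
    (2 / r%:R * (c * x) `^ (- ((s * N + r * k).+1%:R / r%:R)) *
     Gamma ((s * N + r * k).+1%:R / r%:R)).
  rewrite -(big_mkord xpredT (fun k => composition_sum b k N / k`!%:R * x ^+ k *
    (2 / r%:R * (c * x) `^ (- ((s * N + r * k).+1%:R / r%:R)) *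
     Gamma ((s * N + r * k).+1%:R / r%:R)))).
  rewrite (big_cat_nat (leq0n N.+1) (ltn_ord N))/= [X in _ = _ + X]big_nat.
  rewrite [X in _ = _ + X]big1 ?addr0; last first.
    by move=> k /andP[Nk _]; rewrite composition_sum_gt// !mul0r.
  rewrite mulr_suml; apply: eq_bigr => k _.
  have rR : r%:R != 0 :> R by rewrite pnatr_eq0 -lt0n.
  have -> : (s * N + r * k).+1%:R / r%:R = (s * N).+1%:R / r%:R + k%:R :> R.
    by rewrite -addSn natrD natrM; field.
  rewrite powRM ?ltW//; set a := _ / r%:R + _.
  have -> : x `^ (- ((s * N).+1%:R / r%:R)) = x ^+ k * x `^ (- a).
    rewrite -powR_mulrn ?ltW// -powRD; last by rewrite (gt_eqF x0) implybT.
    by congr (_ `^ _); rewrite /a; ring.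
  ring.
apply: has_integral_sum => // k _; apply: has_integralZ.
by apply: even_moment => //; rewrite odd_rk.
Qed.

(** The integrand is compared with its expansion pointwise, on the whole line: near 0 by
    [laplace_local], and away from 0 because both are exponentially small. The
    discrepancy is at most a constant times t^(s (P + 1)) times a decaying
    exponential, whose integral is of the order of the next power of n. The integrand is
    prescribed only near 0, which leaves room for cutting off a
    competing maximizer. *)
Lemma laplace_expansion (r s P : nat) (b : nat -> R) (c : R) (g : R -> R)
    (del C1 : R) (f : nat -> R -> R) (v : nat -> R) :
  (0 < r)%N -> ~~ odd r -> (0 < s)%N -> ~~ odd (s * P.+1) -> 0 < c -> 0 < del ->
  (forall t, `|t| <= del ->
    `|g t + c * `|t| ^+ r - `|t| ^+ r * \sum_(1 <= m < P.+1) b m * t ^+ (s * m)|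
      <= C1 * `|t| ^+ (r + s * P.+1)) ->
  (forall n, (1 <= n)%N -> has_integral setT (f n) (v n)) ->
  (forall n t, (1 <= n)%N -> `|t| <= del -> f n t = expR (n%:R * g t)) ->
  (forall del', 0 < del' -> exists2 kappa, 0 < kappa &
    forall n t, (1 <= n)%N -> del' <= `|t| -> `|f n t| <= expR (- (n%:R * kappa * `|t|))) ->
  exists C, forall n, (1 <= n)%N ->
    `|v n - \sum_(N < P.+1) laplace_coef r s b c N * n%:R `^ (- ((s * N).+1%:R / r%:R))|
      <= C * n%:R `^ (- ((s * P.+1).+1%:R / r%:R)).
Proof.
move=> r0 reven s0 sPeven c0 del0 Hg fv floc ftail.
have [d [d0 dd [A A0 HA]]] := laplace_local s0 c0 del0 Hg.
have [D D0 HD] := laplace_poly_tail r s P b c0 d0.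
have [kappa kappa0 Hkappa] := ftail d d0.
set q := (s * P.+1)%N in sPeven *.
pose rho : R := q.+1%:R / r%:R.
have c40 : 0 < c / 4 by rewrite divr_gt0.
pose K1 := 2 / r%:R * (c / 4) `^ (- rho) * Gamma rho.
pose K2 := 2 / 1%:R * kappa `^ (- (q.+1%:R / 1%:R)) * Gamma (q.+1%:R / 1%:R).
exists ((A + D) * K1 + d^-1 ^+ q * `|K2|) => n n1.
have nR : 0 < n%:R :> R by rewrite ltr0n.
have M1 : has_integral setT (fun t => laplace_error r s P c (n%:R, t))
    (K1 * n%:R `^ (- rho)).
  have := even_moment (mulr_gt0 c40 nR) r0 sPeven.
  rewrite powRM ?ltW// -/rho => M.
  rewrite (_ : K1 * _ = 2 / r%:R * ((c / 4) `^ (- rho) * n%:R `^ (- rho)) * Gamma rho);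
    last by rewrite /K1; ring.
  apply: eq_has_integral M => t _; rewrite /laplace_error/= -/q mulrA.
  by rewrite -(normrX q t) [`|_ ^+ q|]ger0_norm// exprn_even_ge0.
have M2 : has_integral setT (fun t => t ^+ q * expR (- (n%:R * kappa * `|t| ^+ 1)))
    (K2 * n%:R `^ (- (q.+1%:R / 1%:R))).
  have := even_moment (mulr_gt0 nR kappa0) (isT : (0 < 1)%N) sPeven.
  by rewrite powRM ?ltW// /K2; congr has_integral; ring.
have HI := has_integralD (has_integralZ (A + D) M1) (has_integralZ (d^-1 ^+ q) M2).
have := has_integral_dist (fv n n1) (has_integral_laplace_poly s P b r0 reven c0 nR) HI.
move=> H; apply: le_trans (H _) _ => [t _|]; last first.
  rewrite [leRHS]mulrDl mulrA lerD2l -[leRHS]mulrA ler_wpM2l ?exprn_ge0 ?invr_ge0 ?(ltW d0)//.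
  apply: (@le_trans _ _ (`|K2| * n%:R `^ (- (q.+1%:R / 1%:R)))).
    by rewrite ler_wpM2r ?powR_ge0// ler_norm.
  rewrite ler_wpM2l// ler_powR ?ler1n// lerN2 /rho ler_wpM2l//.
  by rewrite lef_pV2 ?posrE ?ltr0n// ler_nat.
have err0 : 0 <= laplace_error r s P c (n%:R, t).
  by rewrite mulr_ge0 ?expR_ge0// exprn_ge0.
have tq0 : 0 <= t ^+ q by rewrite exprn_even_ge0.
have [td|dt] := leP `|t| d.
  rewrite floc ?(le_trans td)//.
  have := HA (n%:R, t) (conj (ltW nR) td) => /= /le_trans; apply.
  have d0q : 0 <= d^-1 ^+ q by rewrite exprn_ge0// invr_ge0 ltW.
  rewrite mulrDl -addrA lerDl addr_ge0//; first exact: mulr_ge0.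
  by rewrite !mulr_ge0 ?expR_ge0.
apply: le_trans (ler_normB _ _) _; rewrite addrC.
apply: lerD.
  have := HD (n%:R, t) (conj (ltW nR) (ltW dt)) => /= /le_trans; apply.
  by rewrite ler_wpM2r// lerDr.
(* Since |t| >= d, the factor (|t| / d)^q is at least 1. *)
apply: (le_trans (Hkappa n t n1 (ltW dt))).
have -> : t ^+ q = `|t| ^+ q by rewrite -normrX ger0_norm.
rewrite expr1 mulrA -exprMn ler_peMl ?expR_ge0//.
by rewrite exprn_ege1// mulrC ler_pdivlMr// mul1r ltW.
Qed.

End laplace.

(** * Chains of derivatives *)

Section derivative_chains.
Context {R : realType}.
Implicit Types (F : nat -> R -> R).

(** All derivatives are given in closed form, so that bounds, parity and values at a point are
    read off without iterating the derivation operator. *)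
Definition derivative_chain F : Prop :=
  forall j (x : R), is_derive x 1 (F j) (F j.+1 x).

Lemma derive1n_chain F : derivative_chain F -> forall j, derive1n j (F 0%N) = F j.
Proof.
move=> dF; elim=> [|j IH]; first by rewrite derive1n0.
rewrite derive1nS IH; apply/funext => x; rewrite derive1E.
by apply: derive_val; exact: dF.
Qed.

Lemma taylor_coef_chain F (t : R) (j : nat) : derivative_chain F ->
  taylor_coef (F 0%N) t j = F j t / j`!%:R.
Proof. by move=> dF; rewrite /taylor_coef derive1n_chain. Qed.

Lemma derivative_chain_parity F : derivative_chain F ->
  (forall x, F 0%N (- x) = F 0%N x) -> forall j x, F j (- x) = (-1) ^+ j * F j x.
Proof.
move=> dF F0; elim=> [|j IH] x; first by rewrite expr0 mul1r.
have d1 : is_derive x 1 (fun y : R => F j (- y)) (F j.+1 (- x) * -1).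
  exact: (is_derive1_comp (dF j (- x)) (is_deriveNid x 1)).
have d2 : is_derive x 1 (fun y : R => F j (- y)) ((-1) ^+ j * F j.+1 x).
  have -> : (fun y : R => F j (- y)) = (fun y => (-1) ^+ j * F j y).
    by apply/funext => y; rewrite IH.
  exact: (is_deriveZ ((-1) ^+ j) (dF j x)).
have := @derive_val _ _ _ _ _ _ _ d1; rewrite (@derive_val _ _ _ _ _ _ _ d2).
by rewrite mulrN1 exprS mulN1r mulNr => ->; rewrite opprK.
Qed.

Lemma odd_derivative0 F j : derivative_chain F ->
  (forall x, F 0%N (- x) = F 0%N x) -> odd j -> F j 0 = 0.
Proof.
move=> dF F0 jodd; have := derivative_chain_parity dF F0 j 0.
by rewrite oppr0 -signr_odd jodd expr1; lra.
Qed.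

Lemma sum_multiples (s n : nat) (G : nat -> R) : (0 < s)%N ->
  (forall j, ~~ (s %| j)%N -> G j = 0) ->
  \sum_(0 <= j < s * n) G j = \sum_(0 <= m < n) G (s * m)%N.
Proof.
move=> s0 G0; elim: n => [|n IH]; first by rewrite muln0 !big_geq.
rewrite big_nat_recr//= -IH mulnS addnC.
rewrite (big_cat_nat (leq0n (s * n)) (leq_addr s (s * n)))/=; congr (_ + _).
rewrite -{1}[(s * n)%N]add0n big_addn addKn.
case: s s0 G0 IH => // s _ G0 _.
rewrite big_nat_recl// add0n big_nat big1 ?addr0// => j /andP[_ js].
apply: G0; rewrite dvdn_addl ?dvdn_mulr//.
by rewrite gtnNdvd.
Qed.

(** The local hypothesis of Laplace's method, by Taylor's bound at order r + s (P + 1): among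
    the derivatives at t, those below order r vanish and beyond it only every s-th one
    survives. *)
Lemma chain_local_expansion F (t c K : R) (r s P : nat) : derivative_chain F ->
  (0 < r)%N -> ~~ odd r -> (0 < s)%N ->
  (forall j, (0 < j < r)%N -> F j t = 0) -> F r t / r`!%:R = - c ->
  (forall j, ~~ (s %| j)%N -> F (r + j)%N t = 0) ->
  (forall x, `|F (r + s * P.+1)%N x| <= K) ->
  forall x, `|x| <= 1 ->
    `|(F 0%N (t + x) - F 0%N t) + c * `|x| ^+ r -
      `|x| ^+ r * \sum_(1 <= m < P.+1)
         taylor_coef (F 0%N) t (r + s * m) * x ^+ (s * m)|
      <= K * `|x| ^+ (r + s * P.+1).
Proof.
move=> dF r0 reven s0 F0 Fr Fs FK x x1.
have HK y : `|y - t| <= 1 -> `|F (r + s * P.+1)%N y| <= K by move=> _; exact: FK.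
have := taylor_bound dF HK (x := t + x); rewrite addrC addKr => /(_ x1).
have -> : `|x| ^+ r = x ^+ r by rewrite -normrX ger0_norm// exprn_even_ge0.
rewrite -(big_mkord xpredT (fun j => F j t / j`!%:R * x ^+ j)).
rewrite (big_cat_nat (leq0n r) (leq_addr (s * P.+1) r))/=.
have -> : \sum_(r <= j < r + s * P.+1) F j t / j`!%:R * x ^+ j =
    \sum_(0 <= j < s * P.+1) F (r + j)%N t / (r + j)`!%:R * x ^+ (r + j).
  by rewrite -{1}[r]add0n big_addn addKn; under eq_bigr do rewrite addnC.
rewrite sum_multiples//; last by move=> j js; rewrite Fs// !mul0r.
rewrite [X in _ - (X + _)]big_ltn// [X in _ - (_ + X + _)]big_nat.
rewrite [X in _ - (_ + X + _)]big1 ?addr0; last by move=> j jr; rewrite F0// !mul0r.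
rewrite [X in _ - (_ + X)]big_ltn// muln0 addn0 Fr.
rewrite fact0 divr1 expr0 mulr1.
have -> : \sum_(1 <= m < P.+1) F (r + s * m)%N t / (r + s * m)`!%:R * x ^+ (r + s * m) =
   x ^+ r * \sum_(1 <= m < P.+1) taylor_coef (F 0%N) t (r + s * m) * x ^+ (s * m).
  rewrite mulr_sumr; apply: eq_bigr => m _; rewrite taylor_coef_chain// exprD; ring.
by apply: le_trans; rewrite le_eqVlt; apply/orP; left; apply/eqP; congr (`|_|); ring.
Qed.

End derivative_chains.

(** * Derivatives of ln cosh *)

Section lncosh.
Context {R : realType}.
Implicit Types (t x : R).

Lemma cosh_gt0 t : 0 < cosh t.
Proof. by rewrite divr_gt0// addr_gt0 ?expR_gt0. Qed.

Lemma cosh_opp t : cosh (- t) = cosh t.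
Proof. by rewrite /cosh opprK addrC. Qed.

Lemma lncosh_opp t : lncosh (- t) = lncosh t.
Proof. by rewrite /lncosh cosh_opp. Qed.

Lemma tanh_le1 t : `|tanh t| <= 1.
Proof.
have e1 := expR_gt0 t; have e2 := expR_gt0 (- t).
have e12 : 0 < expR t + expR (- t) by rewrite addr_gt0.
rewrite /tanh normrM normfV (gtr0_norm e12) ler_pdivrMr// mul1r ler_norml.
by apply/andP; split; lra.
Qed.

Lemma tanh0 : tanh (0 : R) = 0.
Proof. by rewrite /tanh oppr0 subrr mul0r. Qed.

Lemma cosh0 : cosh (0 : R) = 1.
Proof. by rewrite /cosh oppr0 expR0; field. Qed.

Lemma one_sub_sqr_tanh t : 1 - tanh t ^+ 2 = 1 / cosh t ^+ 2.
Proof.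
have e1 := expR_gt0 t; have e2 := expR_gt0 (- t).
have e12 : expR t + expR (- t) != 0 by rewrite gt_eqF// addr_gt0.
have E : expR (- t) = (expR t)^-1 by rewrite expRN.
rewrite /tanh /cosh.
have {2}-> : 1 = (expR t * expR (- t)) ^+ 2 by rewrite E divff ?expr1n// gt_eqF.
have H : expR t * expR (- t) = 1 by rewrite E divff// gt_eqF.
rewrite H expr1n.
have -> : 1 - ((expR t - expR (- t)) / (expR t + expR (- t))) ^+ 2 =
  4 * (expR t * expR (- t)) / (expR t + expR (- t)) ^+ 2 by field.
by rewrite H; field.
Qed.

Lemma is_derive_exp_opp x : is_derive x 1 (fun t : R => expR (- t)) (- expR (- x)).
Proof.
have := is_derive1_comp (is_derive_expR (- x)) (is_deriveNid x 1).
by rewrite mulrN1.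
Qed.

Lemma is_derive_cosh x : is_derive x 1 (@cosh R) ((expR x - expR (- x)) / 2).
Proof.
have -> : @cosh R = fun t => 2^-1 * (expR t + expR (- t)).
  by apply/funext => t; rewrite /cosh mulrC.
rewrite mulrC; apply: (is_deriveZ 2^-1).
exact: (is_deriveD (is_derive_expR x) (is_derive_exp_opp x)).
Qed.

Lemma is_derive_lncosh x : is_derive x 1 (@lncosh R) (tanh x).
Proof.
have := is_derive1_comp (is_derive1_ln (cosh_gt0 x)) (is_derive_cosh x).
move=> H; apply: (is_derive_eq H); rewrite /cosh /tanh.
by field; rewrite gt_eqF// addr_gt0 ?expR_gt0.
Qed.

Lemma is_derive_tanh x : is_derive x 1 (@tanh R) (1 - tanh x ^+ 2).
Proof.
have e12 : expR x + expR (- x) != 0 by rewrite gt_eqF// addr_gt0 ?expR_gt0.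
have dn : is_derive x 1 (fun t : R => expR t - expR (- t)) (expR x - - expR (- x)).
  exact: (is_deriveB (is_derive_expR x) (is_derive_exp_opp x)).
have dd : is_derive x 1 (fun t : R => expR t + expR (- t)) (expR x + - expR (- x)).
  exact: (is_deriveD (is_derive_expR x) (is_derive_exp_opp x)).
have di := @is_deriveV _ (fun t : R => expR t + expR (- t)) x _ 1 e12 dd.
apply: (is_derive_eq (is_deriveM dn di)); rewrite /GRing.scale/= /tanh.
by field.
Qed.

(** The derivatives of tanh are polynomials in tanh, because
    tanh' = 1 - tanh^2; hence they are bounded on the line. *)
Fixpoint tanh_poly (j : nat) : {poly R} :=
  if j is i.+1 then (tanh_poly i)^`() * (1 - 'X^2) else 'X.

Definition lncosh_chain (j : nat) (t : R) : R :=
  if j is i.+1 then (tanh_poly i).[tanh t] else lncosh t.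

Lemma lncosh_chainP : derivative_chain lncosh_chain.
Proof.
case=> [|j] x.
  by have := is_derive_lncosh x; rewrite /lncosh_chain/= hornerX.
have := is_derive1_comp (is_derive_poly (tanh_poly j) (tanh x)) (is_derive_tanh x).
by rewrite /lncosh_chain/= hornerM !hornerE.
Qed.

Lemma lncosh_chain_bounded (j : nat) : exists K, forall t, `|lncosh_chain j.+1 t| <= K.
Proof.
exists (\sum_(i < size (tanh_poly j)) `|(tanh_poly j)`_i|) => t /=.
rewrite horner_coef; apply: le_trans (ler_norm_sum _ _ _) _.
apply: ler_sum => i _; rewrite normrM ler_piMr// normrX exprn_ile1//.
exact: tanh_le1.
Qed.

Lemma lncosh_chain4_at0 : lncosh_chain 4 0 = -2.
Proof. by rewrite /= tanh0 !poly.derivE !hornerE/=; ring. Qed.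

Lemma lncosh_chain2 t : lncosh_chain 2 t = 1 - tanh t ^+ 2.
Proof. by rewrite /= derivX mul1r !hornerE. Qed.

Lemma lncosh_chain_odd (j : nat) : odd j -> lncosh_chain j 0 = 0.
Proof. by apply: odd_derivative0; [exact: lncosh_chainP|exact: lncosh_opp]. Qed.

Lemma lncosh_le t : lncosh t <= `|t|.
Proof.
rewrite -[leRHS]expRK ler_ln ?posrE ?cosh_gt0 ?expR_gt0//.
rewrite /cosh ler_pdivrMr//.
have : expR t <= expR `|t| by rewrite ler_expR ler_norm.
have : expR (- t) <= expR `|t| by rewrite ler_expR -normrN ler_norm.
by lra.
Qed.

End lncosh.

(** * The shape of the mean-field exponent *)

Section mean_field.
Context {R : realType}.
Variables (b h : R).
Hypotheses (b0 : 0 < b) (h0 : 0 <= h).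
Implicit Types (t x : R).

(** The exponent phi of the statement with b = 2 d beta; the case h = 0 is the one without
    field. *)
Definition mf_phi t : R := lncosh t - (t - h) ^+ 2 / (2 * b).

Definition mf_quad (j : nat) t : R :=
  match j with
  | 0%N => (t - h) ^+ 2 / (2 * b)
  | 1%N => (t - h) / b
  | 2%N => 1 / b
  | _ => 0
  end.

Definition mf_chain (j : nat) t : R := lncosh_chain j t - mf_quad j t.

Lemma mf_chainP : derivative_chain mf_chain.
Proof.
move=> j x; have d1 : is_derive x 1 (fun y : R => y - h) 1.
  have := is_deriveB (is_derive_id x (1 : R)) (is_derive_cst h x (1 : R)).
  by rewrite subr0.
have dq : is_derive x 1 (mf_quad j) (mf_quad j.+1 x).
  case: j => [|[|[|j]]] /=.
  - have -> : mf_quad 0 = fun y => (2 * b)^-1 * (y - h) ^+ 2.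
      by apply/funext => y; rewrite /= mulrC.
    have := is_deriveZ (2 * b)^-1 (is_deriveX 2 d1).
    rewrite exprfctE => H; apply: (is_derive_eq H); rewrite /GRing.scale/=.
    by field; rewrite gt_eqF.
  - have -> : mf_quad 1 = fun y => b^-1 * (y - h).
      by apply/funext => y; rewrite /= mulrC.
    by apply: (is_derive_eq (is_deriveZ b^-1 d1)); rewrite /GRing.scale/=; field; rewrite gt_eqF.
  - exact: is_derive_cst.
  - exact: is_derive_cst.
exact: (is_deriveB (lncosh_chainP j x) dq).
Qed.

Lemma mf_chain0E : mf_chain 0 = mf_phi.
Proof. by apply/funext => t; rewrite /mf_chain. Qed.

Lemma mf_chain1E t : mf_chain 1 t = tanh t - (t - h) / b.
Proof. by rewrite /mf_chain /= hornerX. Qed.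

Lemma mf_chain2E t : mf_chain 2 t = 1 - tanh t ^+ 2 - 1 / b.
Proof. by rewrite /mf_chain lncosh_chain2. Qed.

Lemma mf_chain3E (j : nat) t : mf_chain j.+3 t = lncosh_chain j.+3 t.
Proof. by rewrite /mf_chain /= subr0. Qed.

Lemma mf_chain_bounded (j : nat) : (2 < j)%N -> exists K, forall t, `|mf_chain j t| <= K.
Proof.
case: j => [|[|[|j]]]// _; have [K HK] := @lncosh_chain_bounded R j.+2.
by exists K => t; rewrite mf_chain3E.
Qed.

Let dphi x : is_derive x 1 mf_phi (mf_chain 1 x).
Proof. by have := mf_chainP 0 x; rewrite mf_chain0E. Qed.

Lemma continuous_mf_phi : continuous mf_phi.
Proof.
move=> x; apply: differentiable_continuous; apply/derivable1_diffP.
by have [] := dphi x.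
Qed.

Lemma mf_phi_shift t : mf_phi (- t) = mf_phi t - 2 * h * t / b.
Proof. by rewrite /mf_phi lncosh_opp; field; rewrite gt_eqF. Qed.

Lemma chain_mvt (F : nat -> R -> R) (j : nat) (x y : R) : derivative_chain F -> x < y ->
  exists2 z, x < z < y & F j y - F j x = F j.+1 z * (y - x).
Proof.
move=> dF xy; have cF : {within `[x, y], continuous (F j)}.
  apply: continuous_subspaceT => z; apply: differentiable_continuous.
  by apply/derivable1_diffP; have [] := dF j z.
have [z + E] := MVT xy (fun z _ => dF j z) cF.
by rewrite in_itv/= => ?; exists z.
Qed.

Lemma tanh_lt x y : x < y -> tanh x < tanh y.
Proof.
move=> xy; have [z _] := chain_mvt 1 (@lncosh_chainP R) xy.
rewrite lncosh_chain2 one_sub_sqr_tanh /= !hornerX => E.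
by rewrite -subr_gt0 E mulr_gt0 ?subr_gt0// divr_gt0// exprn_gt0// cosh_gt0.
Qed.

Lemma tanh_gt0 x : 0 < x -> 0 < tanh x.
Proof. by move=> x0; rewrite -(@tanh0 R) tanh_lt. Qed.

Lemma tanh_lt_id x : 0 < x -> tanh x < x.
Proof.
move=> x0; have [z /andP[z0 _]] := chain_mvt 1 (@lncosh_chainP R) x0.
rewrite lncosh_chain2 /= !hornerX tanh0 !subr0 => ->.
by rewrite gtr_pMl// ltrBlDr ltrDl exprn_gt0// tanh_gt0.
Qed.

Lemma mf_chain2_lt x y : 0 <= x -> x < y -> mf_chain 2 y < mf_chain 2 x.
Proof.
move=> x0 xy; rewrite !mf_chain2E ltrD2r ltrD2l ltrN2 ltrXn2r//.
- by case: ltgtP x0 => // [/tanh_gt0/ltW//|<- _]; rewrite tanh0.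
- exact: tanh_lt.
Qed.

Definition mf_maximizer t := [/\ 0 < t, mf_chain 1 t = 0, mf_chain 2 t < 0,
  (forall x, t < x -> mf_chain 1 x < 0) & (forall x, 0 < x < t -> 0 < mf_chain 1 x)].

(** On the positive half-line phi' is concave, starts nonnegative, becomes positive
    and ends negative: it changes sign exactly once, with negative slope. It becomes
    positive because of the field, or because its slope 1 - 1 / b at 0 is positive. *)
Lemma mf_maximizer_exists : 0 < h \/ 1 < b -> exists t, mf_maximizer t.
Proof.
move=> hb; have psi0 : 0 <= mf_chain 1 0.
  by rewrite mf_chain1E tanh0 !sub0r mulNr opprK divr_ge0// ltW.
have [t1 t10 t1pos] : exists2 t1, 0 < t1 & 0 < mf_chain 1 t1.
  have [h1|hle0] := ltP 0 h.
    have [t2 t20 small] : exists2 t2, 0 < t2 & t2 / b < h / b.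
      by exists (h / 2); [rewrite divr_gt0|rewrite ltr_pM2r ?invr_gt0//; lra].
    by exists t2 => //; rewrite mf_chain1E; have := tanh_gt0 t20; lra.
  have h00 : h = 0 by apply/eqP; rewrite eq_le hle0.
  have b1 : 1 < b by case: hb => //; rewrite h00 ltxx.
  have bi1 : b^-1 < 1 by rewrite invf_lt1.
  have bi0 : 0 < b^-1 by rewrite invr_gt0.
  pose t1 := (1 - b^-1) / 2.
  have t10 : 0 < t1 by rewrite divr_gt0// subr_gt0.
  exists t1 => //; rewrite mf_chain1E h00 subr0.
  have [z /andP[z0 zt]] := chain_mvt 1 (@lncosh_chainP R) t10.
  rewrite lncosh_chain2 /= !hornerX tanh0 !subr0 => ->.
  rewrite mulrC -mulrBr mulr_gt0//.
  have tz : tanh z < t1 by rewrite (lt_trans (tanh_lt_id z0)).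
  have tz0 := tanh_gt0 z0.
  have t11 : t1 < 1 by rewrite /t1; lra.
  have : tanh z ^+ 2 < t1.
    by rewrite expr2 (lt_trans _ tz)// gtr_pMr// (lt_trans tz).
  by rewrite /t1; lra.
pose T := b + h + t1.
have T1 : t1 < T by rewrite /T ltrDr ltr_wpDr.
have TN : mf_chain 1 T < 0.
  rewrite mf_chain1E subr_lt0 ltr_pdivlMr//.
  have := @tanh_le1 R T; rewrite ler_norml => /andP[_].
  move=> /(ler_wpM2r (ltW b0)); rewrite mul1r => H; apply: (le_lt_trans H).
  by rewrite /T; lra.
have c1 : continuous (mf_chain 1).
  move=> x; apply: differentiable_continuous; apply/derivable1_diffP.
  by have [] := mf_chainP 1 x.
have [t tin tz] : exists2 t, t \in `[t1, T] & mf_chain 1 t = 0.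
  apply: IVT; [exact: ltW|exact: continuous_subspaceT|].
  by rewrite ge_min le_max (ltW TN) (ltW t1pos) orbT.
move: tin; rewrite in_itv/= => /andP[t1t tT].
have {}t1t : t1 < t.
  by rewrite lt_neqAle t1t andbT; apply/eqP => E; move: t1pos; rewrite E tz ltxx.
have t0 : 0 < t by exact: lt_trans t1t.
have tN : mf_chain 2 t < 0.
  have [z /andP[z1 zt] E] := chain_mvt 1 mf_chainP t1t.
  apply: (lt_trans (mf_chain2_lt (ltW (lt_trans t10 z1)) zt)).
  have : mf_chain 2 z * (t - t1) < 0 by rewrite -E tz sub0r oppr_lt0.
  by rewrite pmulr_llt0// subr_gt0.
exists t; split => // x.
- move=> tx; have [z /andP[z1 zx] E] := chain_mvt 1 mf_chainP tx.
  move: E; rewrite tz subr0 => ->; rewrite nmulr_rlt0 ?subr_gt0//.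
  exact: lt_trans (mf_chain2_lt (ltW t0) z1) tN.
- move=> /andP[x0 xt]; rewrite ltNge; apply/negP => xneg.
  have [z /andP[z1 zt] E] := chain_mvt 1 mf_chainP xt.
  have zpos : 0 <= mf_chain 2 z.
    have : 0 <= mf_chain 2 z * (t - x) by rewrite -E tz sub0r oppr_ge0.
    by rewrite pmulr_lge0// subr_gt0.
  have [y /andP[y0 yx] E2] := chain_mvt 1 mf_chainP x0.
  have : 0 < mf_chain 2 y * (x - 0).
    rewrite subr0 mulr_gt0//; apply: le_lt_trans zpos _.
    by apply: mf_chain2_lt; [exact: ltW|exact: lt_trans z1].
  by rewrite -E2 subr_gt0 ltNge => /negP; apply; exact: le_trans xneg psi0.
Qed.

Section gap.
Variable (ts : R).

(** Away from the maximum phi is both at most - eta and at most B - |t|, the latter because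
    it decays quadratically at infinity; the convex combination of the two bounds that
    cancels the constant is linear in |t|. *)
Lemma mf_tail (D : R -> Prop) :
  (forall del, 0 < del -> exists2 eta, 0 < eta &
     forall t, D t -> del <= `|t| -> mf_phi (ts + t) - mf_phi ts <= - eta) ->
  forall del, 0 < del -> exists2 kappa, 0 < kappa &
     forall t, D t -> del <= `|t| -> mf_phi (ts + t) - mf_phi ts <= - (kappa * `|t|).
Proof.
move=> gap del del0; have [eta eta0 Heta] := gap del del0.
pose B := `|2 * b + 2 * h + `|ts| - mf_phi ts|.
have B0 : 0 <= B by exact: normr_ge0.
have lin t : mf_phi (ts + t) - mf_phi ts <= B - `|t|.
  have H1 := lncosh_le (ts + t).
  have H2 : 2 * `|ts + t| <= (ts + t - h) ^+ 2 / (2 * b) + 2 * b + 2 * h.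
    have : `|ts + t| <= `|ts + t - h| + h.
      by have := ler_normD (ts + t - h) h; rewrite subrK (ger0_norm h0).
    have : 2 * `|ts + t - h| <= (ts + t - h) ^+ 2 / (2 * b) + 2 * b.
      rewrite -real_normK ?num_real//; set u := `|_|.
      rewrite -subr_ge0 (_ : _ - _ = (u - 2 * b) ^+ 2 / (2 * b)).
        by rewrite divr_ge0 ?sqr_ge0// mulr_ge0// ltW.
      by field; rewrite gt_eqF.
    by lra.
  have H3 : `|t| <= `|ts + t| + `|ts|.
    by have := ler_normB (ts + t) ts; rewrite addrAC subrr add0r.
  have : 2 * b + 2 * h + `|ts| - mf_phi ts <= B by exact: ler_norm.
  by move: H1 H2 H3; rewrite /mf_phi; lra.
have eB : 0 < eta + B by rewrite ltr_wpDr.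
exists (eta / (eta + B)); first by rewrite divr_gt0.
move=> t Dt dt; have {Heta}H := Heta t Dt dt; have L := lin t.
set x := mf_phi _ - _ in H L *.
have -> : - (eta / (eta + B) * `|t|) = - (eta * `|t|) / (eta + B) by ring.
rewrite ler_pdivlMr//.
have := ler_wpM2l (ltW eta0) L; have := ler_wpM2l B0 H; nra.
Qed.

Lemma mf_increasing : (forall x, 0 < x < ts -> 0 < mf_chain 1 x) ->
  forall x y, 0 <= x -> x < y -> y <= ts -> mf_phi x < mf_phi y.
Proof.
move=> H x y x0 xy yt; have [z /andP[xz zy]] := chain_mvt 0 mf_chainP xy.
rewrite mf_chain0E -subr_gt0 => ->; apply: mulr_gt0; last by rewrite subr_gt0.
by apply: H; rewrite (le_lt_trans x0 xz) (lt_le_trans zy yt).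
Qed.

Lemma mf_decreasing : (forall x, ts < x -> mf_chain 1 x < 0) ->
  forall x y, ts <= x -> x < y -> mf_phi y < mf_phi x.
Proof.
move=> H x y x0 xy; have [z /andP[xz zy]] := chain_mvt 0 mf_chainP xy.
rewrite mf_chain0E -subr_lt0 => ->; rewrite nmulr_rlt0 ?subr_gt0//.
by apply: H; rewrite (le_lt_trans x0 xz).
Qed.

Lemma mf_gap_halfline : mf_maximizer ts -> forall del, 0 < del ->
  exists2 eta, 0 < eta &
    forall t, - ts <= t -> del <= `|t| -> mf_phi (ts + t) - mf_phi ts <= - eta.
Proof.
move=> [ts0 _ _ Hdec Hinc] del del0.
pose d := Num.min del (ts / 2).
have d0 : 0 < d by rewrite lt_min del0 divr_gt0.
have dts : d < ts by rewrite gt_min; apply/orP; right; lra.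
have dd : d <= del by rewrite ge_min lexx.
have up : mf_phi (ts + d) < mf_phi ts by apply: (mf_decreasing Hdec) => //; lra.
have dn : mf_phi (ts - d) < mf_phi ts by apply: (mf_increasing Hinc) => //; lra.
exists (Num.min (mf_phi ts - mf_phi (ts + d)) (mf_phi ts - mf_phi (ts - d))).
  by rewrite lt_min !subr_gt0 up dn.
move=> t tts dt; rewrite lerNr ge_min (opprB (mf_phi (ts + t)) (mf_phi ts)).
have [t0|t0] := leP 0 t.
  apply/orP; left; rewrite lerB//.
  have : d <= t by rewrite (le_trans dd)// -(ger0_norm t0).
  rewrite le_eqVlt => /predU1P[->//|dlt]; apply/ltW/(mf_decreasing Hdec); lra.
apply/orP; right; rewrite lerB//.
have : d <= - t by rewrite (le_trans dd)// -(ltr0_norm t0).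
rewrite le_eqVlt => /predU1P[->|dlt]; first by rewrite opprK.
apply/ltW/(mf_increasing Hinc); lra.
Qed.

(** With a positive field, reflecting a negative point increases phi by an amount
    proportional to its distance from 0; near 0 itself phi is below its maximum already. *)
Lemma mf_gap_line : mf_maximizer ts -> 0 < h -> forall del, 0 < del ->
  exists2 eta, 0 < eta &
    forall t, del <= `|t| -> mf_phi (ts + t) - mf_phi ts <= - eta.
Proof.
move=> tsmax hpos del del0; have [ts0 _ _ _ _] := tsmax.
have [eta1 eta10 H1] := mf_gap_halfline tsmax del0.
have [eta2 eta20 H2] := mf_gap_halfline tsmax (divr_gt0 ts0 (ltr0n R 2)).
have top x : 0 <= x -> mf_phi x <= mf_phi ts.
  move=> x0; have [->//|xts] := eqVneq x ts.
  have : 0 < `|x - ts| by rewrite normr_gt0 subr_eq0.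
  move=> /(mf_gap_halfline tsmax)[e e0 He].
  have := He (x - ts); rewrite addrCA subrr addr0 lexx.
  by move=> /(_ _ isT); rewrite lerBrDr addrC subrr => /(_ x0); lra.
exists (Num.min eta1 (Num.min eta2 (h * ts / b))).
  by rewrite !lt_min eta10 eta20 divr_gt0// mulr_gt0.
move=> t dt; have [tts|tneg] := leP (- ts) t.
  by apply: (le_trans (H1 t tts dt)); rewrite lerN2 ge_min lexx.
pose u := - (ts + t); have u0 : 0 < u by rewrite /u; lra.
have Eu : mf_phi (ts + t) = mf_phi u - 2 * h * u / b.
  by rewrite -mf_phi_shift /u opprK.
have hb0 : 0 <= 2 * h * u / b by rewrite divr_ge0 ?mulr_ge0// ltW.
have [uts|tsu] := leP u (ts / 2).
  apply: (@le_trans _ _ (- eta2)); last by rewrite lerN2 !ge_min lexx orbT.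
  have := H2 (u - ts); rewrite addrCA subrr addr0 lerBrDr addrC subrr.
  move=> /(_ (ltW u0)); rewrite ler0_norm; last by lra.
  by move=> /(_ ltac:(lra)); rewrite Eu; lra.
apply: (@le_trans _ _ (- (h * ts / b))); last by rewrite lerN2 !ge_min lexx !orbT.
have : h * ts / b <= 2 * h * u / b.
  by rewrite ler_pM2r ?invr_gt0//; nra.
by rewrite Eu; have := top u (ltW u0); lra.
Qed.

End gap.

(** Here phi is even, and decreasing on the positive half-line since tanh x < x. *)
Lemma mf_gap_zero : h = 0 -> b <= 1 -> forall del, 0 < del ->
  exists2 eta, 0 < eta &
    forall t, del <= `|t| -> mf_phi (0 + t) - mf_phi 0 <= - eta.
Proof.
move=> h00 b1 del del0.
have neg x : 0 < x -> mf_chain 1 x < 0.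
  move=> x0; rewrite mf_chain1E h00 subr0 subr_lt0.
  by apply: (lt_le_trans (tanh_lt_id x0)); rewrite ler_peMr ?(ltW x0)// invf_ge1.
have dec := mf_decreasing neg.
exists (mf_phi 0 - mf_phi del); first by rewrite subr_gt0 dec.
move=> t dt; rewrite add0r (opprB (mf_phi 0) (mf_phi del)) lerB//.
have -> : mf_phi t = mf_phi `|t|.
  case: (leP 0 t) => [/ger0_norm->//|/ltr0_norm->].
  by rewrite mf_phi_shift h00 mulr0 mul0r mul0r subr0.
move: dt; rewrite le_eqVlt => /predU1P[->//|dt].
by apply/ltW/dec => //; exact: ltW.
Qed.

End mean_field.

(** * Gaussian linearization of the partition function *)

Section hubbard_stratonovich.
Context {R : realType}.

Lemma has_integral_gauss (m s2 : R) : 0 < s2 ->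
  has_integral setT (fun t => expR (- ((t - m) ^+ 2 / (2 * s2)))) (Num.sqrt (2 * pi * s2)).
Proof.
move=> s20; have s0 : Num.sqrt s2 != 0 by rewrite gt_eqF// sqrtr_gt0.
have Hpdf : has_integral setT (normal_pdf m (Num.sqrt s2)) 1.
  apply: ge0_has_integral => //.
  - exact: measurable_normal_pdf.
  - by move=> x _; exact: normal_pdf_ge0.
  - exact: integral_normal_pdf.
have := has_integralZ (Num.sqrt (2 * pi * s2)) Hpdf; rewrite mulr1.
apply: eq_has_integral => x _; rewrite normal_pdfE// /normal_peak /normal_fun.
rewrite sqr_sqrtr ?ltW//.
have -> : s2 * pi *+ 2 = 2 * pi * s2 by rewrite -mulr_natl; ring.
rewrite mulrA divff ?mul1r; first by rewrite mulNr -mulr_natl.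
by rewrite gt_eqF// sqrtr_gt0 !mulr_gt0// pi_gt0.
Qed.

Lemma sum_spins_expR (n : nat) (u : R) :
  \sum_(sigma : {ffun 'I_n -> bool}) expR (u * \sum_j spin R (sigma j)) =
  (2 * cosh u) ^+ n.
Proof.
have -> : 2 * cosh u = \sum_(s : bool) expR (u * spin R s).
  by rewrite big_bool/= mulr1 mulrN1 /cosh mulrCA divff ?mulr1.
rewrite -[in RHS](card_ord n) -prodr_const bigA_distr_bigA.
by apply: eq_bigr => sigma _; rewrite mulr_sumr expR_sum.
Qed.

Lemma partition_function_opp (d n : nat) (beta h : R) :
  partition_function d beta (- h) n = partition_function d beta h n.
Proof.
pose flip (sigma : {ffun 'I_n -> bool}) := [ffun j => ~~ sigma j].
have flipK : involutive flip.
  by move=> sigma; apply/ffunP => j; rewrite !ffunE negbK.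
rewrite /partition_function (reindex_inj (inv_inj flipK)).
apply: eq_bigr => sigma _.
have -> : \sum_j spin R (flip sigma j) = - \sum_j spin R (sigma j).
  rewrite -sumrN; apply: eq_bigr => j _; rewrite ffunE /spin.
  by case: (sigma j) => //=; rewrite opprK.
by rewrite sqrrN mulrNN.
Qed.

Lemma partition_function_norm (d n : nat) (beta h : R) :
  partition_function d beta `|h| n = partition_function d beta h n.
Proof.
by case: (leP 0 h) => [/ger0_norm->//|/ltr0_norm->]; exact: partition_function_opp.
Qed.

(** Linearizing the square: exp (s2 S^2 / 2) is a Gaussian average of exp (u S), and once
    the spins enter linearly, their sum factorizes into cosh u to the power n. *)
Lemma hubbard_stratonovich (d n : nat) (beta h ts : R) : (0 < n)%N ->
  0 < 2 * d%:R * beta ->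
  has_integral setT (fun t => expR (n%:R * mf_phi (2 * d%:R * beta) h (ts + t)))
    (2 ^- n * partition_function d beta h n *
     Num.sqrt (2 * pi * (2 * d%:R * beta / n%:R))).
Proof.
move=> n0 b0; set b := 2 * d%:R * beta in b0 *.
have nR : 0 < n%:R :> R by rewrite ltr0n.
pose s2 := b / n%:R; have s20 : 0 < s2 by rewrite divr_gt0.
pose S (sigma : {ffun 'I_n -> bool}) := \sum_j spin R (sigma j).
rewrite -mulrA /partition_function mulr_suml mulr_sumr -/s2.
have term sigma := has_integralZ (2 ^- n * expR (d%:R * beta / n%:R * S sigma ^+ 2 + h * S sigma))
  (has_integral_gauss (h + s2 * S sigma - ts) s20).
rewrite (eq_bigr (fun sigma => 2 ^- n * expR (d%:R * beta / n%:R * S sigma ^+ 2 + h * S sigma)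
   * Num.sqrt (2 * pi * s2))); last by move=> sigma _; rewrite mulrA.
move: (@has_integral_sum R _ (index_enum _) xpredT setT _ _ measurableT (fun sigma _ => term sigma)).
apply: eq_has_integral => t _.
have -> : expR (n%:R * mf_phi b h (ts + t)) =
    2 ^- n * (2 * cosh (ts + t)) ^+ n * expR (- (n%:R * ((ts + t - h) ^+ 2 / (2 * b)))).
  rewrite /mf_phi mulrBr expRD expRM_natl /lncosh lnK ?posrE ?cosh_gt0//.
  by congr (_ * _); rewrite [(2 * _) ^+ n]exprMn mulKf// expf_neq0.
rewrite -sum_spins_expR mulr_sumr mulr_suml; apply: eq_bigr => sigma _.
rewrite -[LHS]mulrA -[RHS]mulrA; congr (_ * _); rewrite -!expRD; congr expR; rewrite -/(S sigma).
have -> : d%:R * beta = b / 2 by rewrite /b; field.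
by rewrite /s2; field; rewrite !gt_eqF.
Qed.

(** Isolates one of two symmetric peaks, recentred at 0. *)
Lemma even_has_integral_right (f : R -> R) (v ts : R) : continuous f ->
  (forall x, 0 <= f x) -> (forall x, f (- x) = f x) -> has_integral setT f v ->
  has_integral setT (fun t => if - ts <= t then f (ts + t) else 0) (v / 2).
Proof.
move=> cf f0 fe Hv; have H := even_has_integral_half cf f0 fe Hv.
have mf := continuous_measurable_fun cf.
have cft : continuous (fun t => f (t + ts)).
  move=> x; apply: (@continuous_comp R R R (fun t => t + ts) f); last exact: cf.
  by apply: cvgD; [exact: cvg_id|exact: cvg_cst].
have E : (\int[@lebesgue_measure R]_(x in `[(- ts)%R, +oo[) (f (x + ts))%:E = (v / 2)%:E)%E.
  have {H}H : (\int[@lebesgue_measure R]_(x in `[(- ts + ts)%R, +oo[) (f x)%:E = (v / 2)%:E)%E.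
    by rewrite addNr.
  rewrite -H.
  have D : derive1 (fun t : R => t + ts) = cst 1.
    apply/funext => t; rewrite derive1E; apply: derive_val.
    have := is_deriveD (is_derive_id t (1 : R)) (is_derive_cst ts t (1 : R)).
    by rewrite addr0.
  rewrite (@increasing_ge0_integration_by_substitutiony _ (fun t => t + ts) f (- ts))//.
  - by apply: eq_integral => x _; rewrite D !fctE mulr1.
  - by move=> x y _ _ xy; rewrite ltrD2r.
  - by move=> x _; rewrite D; exact: cst_continuous.
  - by rewrite D; exact: is_cvg_cst.
  - by rewrite D; exact: is_cvg_cst.
  - split.
      by move=> x _; apply: derivableD; [exact: derivable_id|exact: derivable_cst].
    apply: cvg_at_right_filter.
    by apply: cvgD; [exact: cvg_id|exact: cvg_cst].
  - exact: cvg_addrr.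
  - exact: continuous_subspaceT.
apply: ge0_has_integral => //.
- apply: measurable_fun_if => //.
  + by apply: measurable_fun_ler => //; exact: measurable_cst.
  + apply: measurable_funTS; apply: continuous_measurable_fun.
    by under eq_fun do rewrite addrC.
- by move=> x _; case: ifP.
- rewrite -E [RHS]integral_mkcond; apply: eq_integral => t _.
  rewrite patchE (_ : (t \in _) = (- ts <= t)); first by case: ifP; rewrite // addrC.
  by apply/idP/idP; rewrite inE/= in_itv/= andbT.
Qed.

End hubbard_stratonovich.

(** * From integrals to asymptotic expansions *)

Section assembly.
Context {R : realType}.

Lemma expands_as_powR (Z A S r W : nat -> R) (C e : R) : 0 < e ->
  (forall n, (1 <= n)%N -> Z n = A n * W n) ->
  (forall n, (1 <= n)%N -> 0 <= r n) ->
  (forall n, (1 <= n)%N -> `|W n - S n| <= C * n%:R `^ (- e) * r n) ->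
  expands_as Z A S r.
Proof.
move=> e0 ZW r0 HW; exists (fun n => W n - S n).
  by move=> n n1; rewrite ZW// addrC subrK.
apply/eqoP => eps eps0; near=> n.
have n1 : (1 <= n)%N by near: n; exact: nbhs_infty_ge.
have nR : 0 < n%:R :> R by rewrite ltr0n.
apply: (le_trans (HW n n1)); rewrite [X in _ <= _ * X]ger0_norm ?r0//.
apply: ler_wpM2r; first exact: r0.
have [C0|C0] := leP C 0.
  by apply: (@le_trans _ _ 0); [rewrite mulr_le0_ge0// powR_ge0|exact: ltW].
rewrite powRN ler_pdivrMr ?powR_gt0// -ler_pdivrMl//.
have Ce : 0 < eps^-1 * C by rewrite mulr_gt0// invr_gt0.
have : (eps^-1 * C) `^ e^-1 <= n%:R.
  near: n; exact: nbhs_infty_ger.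
move=> /(ge0_ler_powR (ltW e0)); rewrite !nnegrE powR_ge0 (ltW nR) => /(_ isT isT).
by rewrite -powRrM mulVf ?gt_eqF// powRr1// ltW.
Unshelve. all: by end_near. Qed.

Lemma eq_composition_sum (b1 b2 : nat -> R) (k N : nat) :
  (forall m, (0 < m)%N -> b1 m = b2 m) -> composition_sum b1 k N = composition_sum b2 k N.
Proof.
move=> E; rewrite /composition_sum; apply: eq_bigr => f /andP[/forallP fpos _].
by apply: eq_bigr => i _; exact/E.
Qed.

(** For r = 2 the moments involved are Gaussian, hence the double factorials. *)
Lemma laplace_coef_gauss (s N p : nat) (b : nat -> R) (c : R) : 0 < c ->
  (s * N = 2 * p)%N ->
  laplace_coef 2 s b c N = Num.sqrt (pi / c) *
    \sum_(0 <= k < N.+1) (odd_dfact (p + k))%:R / k`!%:R * (2 * c) ^- (p + k)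
      * composition_sum b k N.
Proof.
move=> c0 sN; rewrite /laplace_coef sN oddM/= mulr_sumr; apply: eq_bigr => k _.
have -> : (2 * p).+1%:R / 2%:R + k%:R = (p + k)%:R + 1 / 2 :> R.
  by rewrite -natr1 natrM natrD; field.
rewrite Gamma_half_odd opprD powRD; last by rewrite (gt_eqF c0) implybT.
rewrite powR_invn ?(ltW c0)// powRN mul1r powR12_sqrt ?(ltW c0)//.
rewrite sqrtrM ?pi_ge0// sqrtrV ?(ltW c0)// exprMn.
have f0 : k`!%:R != 0 :> R by rewrite pnatr_eq0 -lt0n fact_gt0.
field; rewrite f0 !expf_neq0 ?gt_eqF// sqrtr_gt0//.
Qed.

(** The domain D cuts off the part of the line that belongs to another maximizer. *)
Lemma mf_expansion (b h ts c del0 : R) (r s P : nat) (D : R -> bool) (v : nat -> R) :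
  0 < b -> 0 <= h -> (0 < r)%N -> ~~ odd r -> (0 < s)%N -> ~~ odd (s * P.+1) ->
  0 < c -> 0 < del0 -> (forall t, `|t| <= del0 -> D t) ->
  (forall j, (0 < j < r)%N -> mf_chain b h j ts = 0) ->
  mf_chain b h r ts / r`!%:R = - c ->
  (forall j, ~~ (s %| j)%N -> mf_chain b h (r + j) ts = 0) ->
  (forall del, 0 < del -> exists2 eta, 0 < eta &
     forall t, D t -> del <= `|t| -> mf_phi b h (ts + t) - mf_phi b h ts <= - eta) ->
  (forall n, (1 <= n)%N -> has_integral setT
     (fun t => if D t then expR (n%:R * (mf_phi b h (ts + t) - mf_phi b h ts)) else 0) (v n)) ->
  exists C, forall n, (1 <= n)%N ->
    `|v n - \sum_(N < P.+1)
        laplace_coef r s (fun m => taylor_coef (mf_phi b h) ts (r + s * m)) c N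
        * n%:R `^ (- ((s * N).+1%:R / r%:R))|
      <= C * n%:R `^ (- ((s * P.+1).+1%:R / r%:R)).
Proof.
move=> b0 h0 r0 reven s0 sPeven c0 del00 Ddel Fj Fr Fs gap Hv.
have [K HK] : exists K, forall t, `|mf_chain b h (r + s * P.+1) t| <= K.
  apply: mf_chain_bounded.
  have r2 : (2 <= r)%N by case: r r0 reven {Fj Fr Fs} => [|[|r]].
  by rewrite -addn1 leq_add// muln_gt0 s0.
pose g t := mf_phi b h (ts + t) - mf_phi b h ts.
have del1 : 0 < Num.min del0 1 by rewrite lt_min del00 ltr01.
apply: (@laplace_expansion _ r s P _ c g (Num.min del0 1) K
  (fun n t => if D t then expR (n%:R * g t) else 0)) => //.
- move=> t; rewrite le_min => /andP[_ t1].
  have := chain_local_expansion (mf_chainP h b0) r0 reven s0 Fj Fr Fs HK t1.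
  by rewrite mf_chain0E.
- by move=> n t n1; rewrite le_min => /andP[td _]; rewrite Ddel.
- move=> del' del'0.
  have [kappa kappa0 Hkappa] := mf_tail b0 h0 gap del'0; exists kappa => // n t n1 td.
  case: ifPn => [Dt|_]; last by rewrite normr0 expR_ge0.
  rewrite ger0_norm ?expR_ge0// ler_expR -mulrA -mulrN ler_wpM2l//.
  exact: Hkappa.
Qed.

(** The normalization sqrt (2 pi b / n) of the Gaussian linearization is divided out, and mu is
    the number of maximizers, of which v sees only one. *)
Lemma normalized_expansion (b mu c : R) (r s P : nat) (a : nat -> R) (v W : nat -> R) :
  0 < b -> 0 < mu ->
  (forall n, (1 <= n)%N -> v n = W n * Num.sqrt (2 * pi * (b / n%:R)) / mu) ->
  (exists C, forall n, (1 <= n)%N ->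
    `|v n - \sum_(N < P.+1) laplace_coef r s a c N * n%:R `^ (- ((s * N).+1%:R / r%:R))|
      <= C * n%:R `^ (- ((s * P.+1).+1%:R / r%:R))) ->
  exists C, forall n, (1 <= n)%N ->
    `|W n - \sum_(N < P.+1) mu / Num.sqrt (2 * pi * b) * laplace_coef r s a c N *
         n%:R `^ (1 / 2 - (s * N).+1%:R / r%:R)|
      <= C * n%:R `^ (1 / 2 - (s * P.+1).+1%:R / r%:R).
Proof.
move=> b0 mu0 vW [C HC]; set kappa := Num.sqrt (2 * pi * b).
have pib : 0 < 2 * pi * b by rewrite !mulr_gt0// pi_gt0.
have kappa0 : 0 < kappa by rewrite sqrtr_gt0.
exists (mu / kappa * C) => n n1; have nR : 0 < n%:R :> R by rewrite ltr0n.
have pw x : n%:R `^ (1 / 2 - x) = Num.sqrt n%:R * n%:R `^ (- x) :> R.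
  by rewrite powRD ?(gt_eqF nR) ?implybT// mul1r powR12_sqrt// ltW.
have sn0 : 0 < Num.sqrt n%:R :> R by rewrite sqrtr_gt0.
have -> : W n = mu / kappa * Num.sqrt n%:R * v n.
  rewrite vW// [2 * pi * (b / _)]mulrA sqrtrM ?(ltW pib)//.
  rewrite sqrtrV ?(ltW nR)// -/kappa; field.
  by rewrite !gt_eqF.
have -> : \sum_(N < P.+1) mu / kappa * laplace_coef r s a c N *
         n%:R `^ (1 / 2 - (s * N).+1%:R / r%:R) =
   mu / kappa * Num.sqrt n%:R *
   \sum_(N < P.+1) laplace_coef r s a c N * n%:R `^ (- ((s * N).+1%:R / r%:R)).
  by rewrite mulr_sumr; apply: eq_bigr => N _; rewrite pw; ring.
rewrite -mulrBr normrM ger0_norm; last by rewrite mulr_ge0 ?divr_ge0// ltW.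
rewrite pw; have := HC n n1 => /(ler_wpM2l (_ : 0 <= mu / kappa * Num.sqrt n%:R)).
move=> H; apply: le_trans (H _) _; first by rewrite mulr_ge0 ?divr_ge0// ltW.
by rewrite le_eqVlt; apply/orP; left; apply/eqP; ring.
Qed.

End assembly.

Section cases.
Context {R : realType}.

Definition scaled_partition (d : nat) (beta h ts : R) (n : nat) : R :=
  expR (- (n%:R * mf_phi (2 * d%:R * beta) h ts)) * (2 ^- n * partition_function d beta h n).

Lemma scaled_partitionE (d : nat) (beta h ts : R) (n : nat) :
  partition_function d beta h n =
  2 ^+ n * expR (n%:R * mf_phi (2 * d%:R * beta) h ts) * scaled_partition d beta h ts n.
Proof.
rewrite /scaled_partition expRN; set x := expR _; have x0 : x != 0 by rewrite gt_eqF ?expR_gt0.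
by field; rewrite x0 expf_neq0.
Qed.

Lemma has_integral_scaled (d : nat) (beta h ts : R) (n : nat) : (0 < n)%N ->
  0 < 2 * d%:R * beta ->
  has_integral setT (fun t => expR (n%:R *
      (mf_phi (2 * d%:R * beta) h (ts + t) - mf_phi (2 * d%:R * beta) h ts)))
    (scaled_partition d beta h ts n * Num.sqrt (2 * pi * (2 * d%:R * beta / n%:R))).
Proof.
move=> n0 b0; have := hubbard_stratonovich h ts n0 b0.
move=> /(has_integralZ (expR (- (n%:R * mf_phi (2 * d%:R * beta) h ts)))).
rewrite [X in has_integral _ _ X -> _]mulrA; apply: eq_has_integral => t _.
by rewrite -expRD; congr expR; ring.
Qed.

Lemma has_integral_scaled_right (d : nat) (beta ts : R) (n : nat) : (0 < n)%N ->
  0 < 2 * d%:R * beta ->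
  has_integral setT (fun t => if - ts <= t then expR (n%:R *
      (mf_phi (2 * d%:R * beta) 0 (ts + t) - mf_phi (2 * d%:R * beta) 0 ts)) else 0)
    (scaled_partition d beta 0 ts n * Num.sqrt (2 * pi * (2 * d%:R * beta / n%:R)) / 2).
Proof.
move=> n0 b0; set b := 2 * d%:R * beta in b0 *.
have H0 := has_integral_scaled 0 0 n0 b0.
pose f u := expR (n%:R * (mf_phi b 0 u - mf_phi b 0 ts)).
have Hf : has_integral setT f (scaled_partition d beta 0 ts n * Num.sqrt (2 * pi * (b / n%:R))).
  have := hubbard_stratonovich 0 0 n0 b0.
  move=> /(has_integralZ (expR (- (n%:R * mf_phi b 0 ts)))).
  rewrite [X in has_integral _ _ X -> _]mulrA; apply: eq_has_integral => t _.
  by rewrite -expRD /f add0r; congr expR; ring.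
apply: (even_has_integral_right (f := f)) => //.
- move=> x; apply: continuous_comp; last exact: continuous_expR.
  apply: cvgM; first exact: cvg_cst.
  by apply: cvgB; [exact: continuous_mf_phi|exact: cvg_cst].
- by move=> x; exact: expR_ge0.
- by move=> x; rewrite /f mf_phi_shift// mulr0 !mul0r subr0.
Qed.

Lemma sqrt_ratio (b c : R) : 0 < b -> 0 < c ->
  Num.sqrt (pi / c) / Num.sqrt (2 * pi * b) = (2 * b * c) `^ (- (1 / 2)).
Proof.
move=> b0 c0; have pi0 := @pi_gt0 R.
rewrite powRN mul1r powR12_sqrt; last by rewrite !mulr_ge0// ltW.
have -> : 2 * pi * b = 2 * b * pi by ring.
have b20 : 0 < 2 * b by rewrite mulr_gt0.
rewrite sqrtrM ?(ltW pi0)// sqrtrV ?(ltW c0)// [Num.sqrt (2 * b * pi)]sqrtrM ?(ltW b20)//.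
rewrite [Num.sqrt (2 * b * c)]sqrtrM ?(ltW b20)//.
by field; rewrite !gt_eqF// sqrtr_gt0.
Qed.

Lemma powR_half_diff (n m : nat) : (0 < n)%N ->
  n%:R `^ (1 / 2 - (2 * m).+1%:R / 2) = n%:R ^- m :> R.
Proof.
move=> n0; rewrite -powR_invn//; congr (_ `^ _).
by rewrite -[(2 * m).+1%:R]natr1 natrM; field.
Qed.

(** The common expansion at a nondegenerate maximum: odd powers of t
    integrate to zero, so only integer powers of 1 / n survive. *)
Lemma saddle_expansion (d : nat) (beta h ts mu del0 : R) (D : R -> bool) (M : nat) :
  let b := 2 * d%:R * beta in let c := - (mf_chain b h 2 ts / 2) in
  0 < b -> 0 <= h -> 0 < mu -> 0 < del0 -> (forall t, `|t| <= del0 -> D t) ->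
  mf_chain b h 1 ts = 0 -> mf_chain b h 2 ts < 0 ->
  (forall del, 0 < del -> exists2 eta, 0 < eta &
     forall t, D t -> del <= `|t| -> mf_phi b h (ts + t) - mf_phi b h ts <= - eta) ->
  (forall n, (1 <= n)%N -> has_integral setT
     (fun t => if D t then expR (n%:R * (mf_phi b h (ts + t) - mf_phi b h ts)) else 0)
     (scaled_partition d beta h ts n * Num.sqrt (2 * pi * (b / n%:R)) / mu)) ->
  exists C, forall n, (1 <= n)%N ->
    `|scaled_partition d beta h ts n - \sum_(0 <= p < M.+1)
        (mu * (2 * b * c) `^ (- (1 / 2)) *
         \sum_(0 <= k < (2 * p).+1) (odd_dfact (p + k))%:R / k`!%:R * (2 * c) ^- (p + k)
           * composition_sum (fun m => taylor_coef (mf_phi b h) ts (m + 2)) k (2 * p))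
        * n%:R ^- p|
      <= C * n%:R `^ (- 1) * n%:R ^- M.
Proof.
move=> b c b0 h0 mu0 del00 Ddel ch1 ch2 gap HI.
have c0 : 0 < c by rewrite oppr_gt0 pmulr_llt0// invr_gt0.
pose a m := taylor_coef (mf_phi b h) ts (2 + 1 * m).
have Fj j : (0 < j < 2)%N -> mf_chain b h j ts = 0 by case: j => [|[|]].
have Fr : mf_chain b h 2 ts / 2`!%:R = - c by rewrite /c opprK.
have Fs j : ~~ (1 %| j)%N -> mf_chain b h (2 + j) ts = 0 by rewrite dvd1n.
have even2 : ~~ odd (1 * (2 * M).+2) by rewrite mul1n /= negbK oddM.
have [C HC] := normalized_expansion b0 mu0 (fun n _ => erefl)
  (mf_expansion b0 h0 (isT : (0 < 2)%N) isT (isT : (0 < 1)%N) even2 c0 del00 Ddel Fj Fr Fs gap HI).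
exists C => n n1; have {HC} := HC n n1.
have -> : n%:R `^ (1 / 2 - (1 * (2 * M).+2).+1%:R / 2%:R) = n%:R `^ (- 1) * n%:R ^- M :> R.
  have -> : (1 * (2 * M).+2)%N = (2 * M.+1)%N by rewrite mul1n mulnS.
  rewrite powR_half_diff// powR_inv1// exprS invfM//.
rewrite mulrA.
rewrite -(big_mkord xpredT (fun N => mu / Num.sqrt (2 * pi * b) * laplace_coef 2 1 a c N *
   n%:R `^ (1 / 2 - (1 * N).+1%:R / 2%:R))).
have -> : (2 * M).+2 = (2 * M.+1)%N by rewrite mulnS.
rewrite sum_multiples//; last first.
  by move=> j; rewrite dvdn2 negbK => jodd; rewrite /laplace_coef mul1n jodd mulr0 mul0r.
move=> H; apply: le_trans H; rewrite le_eqVlt; apply/orP; left; apply/eqP.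
congr (`|_ - _|); apply: eq_bigr => p _.
rewrite mul1n powR_half_diff//; congr (_ * _).
rewrite (@laplace_coef_gauss _ _ _ p)// ?mul1n// -sqrt_ratio//.
set S1 := \sum_(0 <= k < _) _; set S2 := \sum_(0 <= k < _) _.
have -> : S1 = S2; last by ring.
apply: eq_bigr => k _; congr (_ * _); apply: eq_composition_sum => m _.
by rewrite /a mul1n addnC.
Qed.

Lemma maximizer_fixpoint (b h ts : R) : 0 < b -> mf_maximizer b h ts -> 0 <= h ->
  let z := (ts - h) / b in
  [/\ 0 < z, b * z + h = ts & maximal_fixpoint (fun y => tanh (b * y + h)) z].
Proof.
move=> b0 [ts0 ch1 _ Hdec _] h0 z.
have zt : tanh ts = z by move: ch1; rewrite mf_chain1E => /eqP; rewrite subr_eq0 => /eqP.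
have bz : b * z + h = ts by rewrite /z mulrCA divff ?gt_eqF// mulr1 subrK.
split => //; first by rewrite -zt tanh_gt0.
split; first by rewrite bz.
move=> y Fy; rewrite leNgt; apply/negP => zy.
have : ts < b * y + h by rewrite -bz ltrD2r ltr_pM2l.
move=> /Hdec; rewrite mf_chain1E Fy addrK mulrAC divff ?gt_eqF// mul1r subrr.
by rewrite ltxx.
Qed.

Lemma maximizer_taylor (b h ts : R) : 0 < b -> mf_maximizer b h ts ->
  let a := taylor_coef (mf_phi b h) ts in
  [/\ a 1%N = 0, 2 * a 2%N = 1 / cosh ts ^+ 2 - 1 / b, 2 * a 2%N < 0 &
      2 * - (mf_chain b h 2 ts / 2) = - (2 * a 2%N)].
Proof.
move=> b0 [_ ch1 ch2 _ _] a.
have aE j : a j = mf_chain b h j ts / j`!%:R.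
  by rewrite /a -mf_chain0E taylor_coef_chain//; exact: mf_chainP.
have a2 : 2 * a 2%N = mf_chain b h 2 ts by rewrite aE (_ : 2`!%:R = 2 :> R)//; field.
split; first by rewrite aE ch1 mul0r.
- by rewrite a2 mf_chain2E one_sub_sqr_tanh.
- by rewrite a2.
- by rewrite a2; field.
Qed.

End cases.

(** * The four regimes *)

Section theorem_cases.
Context {R : realType}.
Variables (d : nat) (beta : R).
Hypothesis d_ge1 : (1 <= d)%N.

Let d0 : 0 < d%:R :> R. Proof. by rewrite ltr0n. Qed.

Lemma phi_zeroE : 0 < beta -> phi_zero d beta = mf_phi (2 * d%:R * beta) 0.
Proof.
move=> beta0; apply/funext => t; rewrite /phi_zero /mf_phi subr0 /lncosh.
by congr (_ - _ / _); ring.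
Qed.

Lemma phi_fieldE (h : R) : 0 < beta -> phi_field d beta h = mf_phi (2 * d%:R * beta) `|h|.
Proof.
move=> beta0; apply/funext => t; rewrite /phi_field /mf_phi /lncosh.
by congr (_ - _ / _); ring.
Qed.

Lemma mf_phi00 (b : R) : mf_phi b 0 0 = 0.
Proof. by rewrite /mf_phi subr0 expr0n/= mul0r subr0 /lncosh cosh0 ln1. Qed.

Lemma taylor_coef_mf_lncosh (b : R) (j : nat) : 0 < b ->
  taylor_coef (mf_phi b 0) 0 j.+3 = taylor_coef (@lncosh R) 0 j.+3.
Proof.
move=> b0; rewrite -mf_chain0E taylor_coef_chain; last exact: mf_chainP.
rewrite -[@lncosh R]/(lncosh_chain 0) taylor_coef_chain; last exact: lncosh_chainP.
by rewrite mf_chain3E.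
Qed.

Lemma gauss_sum0 (x : R) (a : nat -> R) :
  \sum_(0 <= k < (2 * 0).+1) (odd_dfact (0 + k))%:R / k`!%:R * x ^- (0 + k) *
    composition_sum a k (2 * 0) = 1.
Proof.
rewrite big_nat1 composition_sum0 addn0 /odd_dfact big_ord0 eqxx fact0.
by rewrite (expr0 x) !divr1 !mulr1.
Qed.

Lemma gauss_sum_pos (p : nat) (x : R) (a : nat -> R) : (0 < p)%N ->
  \sum_(0 <= k < (2 * p).+1) (odd_dfact (p + k))%:R / k`!%:R * x ^- (p + k) *
    composition_sum a k (2 * p) =
  \sum_(1 <= k < (2 * p).+1) (odd_dfact (p + k))%:R / k`!%:R * x ^- (p + k) *
    composition_sum a k (2 * p).
Proof.
by move=> p0; rewrite big_ltn// composition_sum_pos0 ?muln_gt0// mulr0 add0r.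
Qed.

(** The maximizer is 0, where phi is even and has second derivative 1 - 1 / b < 0; hence
    r = s = 2 and c = (1 / b - 1) / 2. *)
Lemma subcritical_expansion (M : nat) : 0 < beta -> beta < beta_c R d ->
  expands_as (partition_function d beta 0) (fun n => 2 ^+ n)
    (fun n => \sum_(0 <= p < M.+1) e_sub d beta p * n%:R ^- p) (fun n => n%:R ^- M).
Proof.
move=> beta0; rewrite /beta_c ltr_pdivlMr ?mulr_gt0// mulrC => b1.
set b := 2 * d%:R * beta in b1; have b0 : 0 < b by rewrite !mulr_gt0.
have b10 : 0 < 1 - b by rewrite subr_gt0.
pose c := (b^-1 - 1) / 2.
have c0 : 0 < c by rewrite divr_gt0// subr_gt0 invf_gt1.
have Fj j : (0 < j < 2)%N -> mf_chain b 0 j 0 = 0.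
  by case: j => [|[|]]// _; rewrite mf_chain1E tanh0 subrr mul0r subrr.
have Fr : mf_chain b 0 2 0 / 2`!%:R = - c.
  rewrite mf_chain2E tanh0 (_ : 2`!%:R = 2 :> R)// expr0n/= subr0 /c.
  by field; rewrite gt_eqF.
have Fs j : ~~ (2 %| j)%N -> mf_chain b 0 (2 + j) 0 = 0.
  case: j => // j; rewrite dvdn2 negbK => jodd.
  by rewrite mf_chain3E lncosh_chain_odd//= negbK.
have ev : ~~ odd (2 * M.+1) by rewrite oddM.
have gap del : 0 < del -> exists2 eta, 0 < eta & forall t : R, true -> del <= `|t| ->
    mf_phi b 0 (0 + t) - mf_phi b 0 0 <= - eta.
  move=> del0; have [eta eta0 H] := mf_gap_zero b0 erefl (ltW b1) del0.
  by exists eta => // t _; exact: H.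
have HI n : (1 <= n)%N -> has_integral setT
    (fun t => if true then expR (n%:R * (mf_phi b 0 (0 + t) - mf_phi b 0 0)) else 0)
    (scaled_partition d beta 0 0 n * Num.sqrt (2 * pi * (b / n%:R)) / 1).
  by move=> n1; rewrite divr1; exact: has_integral_scaled.
have [C HC] := normalized_expansion b0 ltr01 (fun n _ => erefl)
  (mf_expansion b0 (lexx 0) (isT : (0 < 2)%N) isT (isT : (0 < 2)%N) ev c0 ltr01
     (fun _ _ => isT) Fj Fr Fs gap HI).
apply: (@expands_as_powR _ _ _ _ _ (scaled_partition d beta 0 0) C 1) => //.
- by move=> n _; rewrite {1}(scaled_partitionE d beta 0 0) mf_phi00 mulr0 expR0 mulr1.
move=> n n1; have := HC n n1.
rewrite powR_half_diff// exprS invfM powR_inv1// -[C / _ / _]mulrA.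
move=> H; apply: le_trans H; rewrite le_eqVlt; apply/orP; left; apply/eqP.
congr (`|_ - _|); rewrite big_mkord; apply: eq_bigr => -[p /= _] _.
rewrite powR_half_diff//; congr (_ * _).
rewrite (@laplace_coef_gauss _ _ _ p)// mulrA mul1r [_^-1 * _]mulrC sqrt_ratio//.
have -> : 2 * b * c = 1 - b by rewrite /c; field; rewrite gt_eqF.
rewrite /e_sub -/b; case: eqP => [->|/eqP p0].
  rewrite big_nat1 composition_sum0 addn0 /odd_dfact big_ord0 eqxx fact0.
  by rewrite (expr0 (2 * c)) !divr1 !mulr1.
rewrite [X in _ = _ * X]big_ltn// composition_sum_pos0 ?lt0n// mulr0 add0r.
rewrite mulr_sumr big_nat [RHS]big_nat; apply: eq_bigr => k /andP[k1 _].
have -> : composition_sum (fun m => taylor_coef (mf_phi b 0) 0 (2 + 2 * m)) k p =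
    composition_sum (fun m => taylor_coef (@lncosh R) 0 (2 * (m + 1))) k p.
  apply: eq_composition_sum => -[//|m] _.
  have -> : (2 + 2 * m.+1)%N = (2 * m).+4 by rewrite mulnS.
  have -> : (2 * (m.+1 + 1))%N = (2 * m).+4 by rewrite addn1 !mulnS.
  exact: taylor_coef_mf_lncosh.
have -> : (1 - b) `^ (- ((2 * p + 2 * k + 1)%N%:R / 2)) =
    (1 - b) `^ (- (1 / 2)) * (1 - b) ^- (p + k).
  rewrite -powR_invn ?(ltW b10)// -powRD; last by rewrite (gt_eqF b10) implybT.
  by congr (_ `^ _); rewrite !natrD; field.
have -> : 2 * c = (1 - b) / b by rewrite /c; field; rewrite gt_eqF.
by rewrite [((1 - b) / b) ^+ _]exprMn exprVn invfM invrK; ring.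
Qed.

(** At beta = 0 the Gaussian variable degenerates, but Z_n is 2^n and all e_p with p >= 1
    vanish. *)
Lemma infinite_temperature_expansion (M : nat) : beta = 0 ->
  expands_as (partition_function d beta 0) (fun n => 2 ^+ n)
    (fun n => \sum_(0 <= p < M.+1) e_sub d beta p * n%:R ^- p) (fun n => n%:R ^- M).
Proof.
move=> ->; apply: (@expands_as_powR _ _ _ _ _ (fun=> 1) 0 1) => //.
- move=> n _; rewrite /partition_function mulr1.
  under eq_bigr do rewrite mulr0 !mul0r addr0 expR0.
  by rewrite sumr_const card_ffun card_bool card_ord natrX.
move=> n n1; rewrite mul0r mul0r big_ltn// big_nat big1.
  by rewrite addr0 /e_sub/= mulr0 subr0 powR1 expr0 divr1 subrr normr0.
move=> p /andP[p0 _]; rewrite /e_sub gtn_eqF// big_nat big1 ?mul0r// => k _.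
by rewrite mulr0 expr0n addn_eq0 gtn_eqF//= mulr0 !mul0r.
Qed.

(** At b = 1 the second derivative of phi vanishes at 0, and the fourth is - 2: r = 4, s = 2 and
    c = 1 / 12, so the moments are values of Gamma at quarter-integers. *)
Lemma critical_expansion (M : nat) : beta = beta_c R d ->
  expands_as (partition_function d beta 0) (fun n => 2 ^+ n)
    (fun n => \sum_(0 <= p < M.+1) e_crit R p * n%:R `^ (- (p%:R / 2) + 1 / 4))
    (fun n => n%:R `^ (- (M%:R / 2) + 1 / 4)).
Proof.
move=> betaE; have bE : 2 * d%:R * beta = 1.
  by rewrite betaE /beta_c; field; rewrite gt_eqF.
have b0 : 0 < 2 * d%:R * beta by rewrite bE.
have Fj j : (0 < j < 4)%N -> mf_chain 1 0 j 0 = 0 :> R.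
  case: j => [|[|[|[|]]]]// _.
  - by rewrite mf_chain1E tanh0 subrr mul0r subrr.
  - by rewrite mf_chain2E tanh0 expr0n/= subr0 divr1 subrr.
  - by rewrite mf_chain3E lncosh_chain_odd.
have Fr : mf_chain 1 0 4 0 / 4`!%:R = - 12^-1 :> R.
  rewrite mf_chain3E lncosh_chain4_at0.
  by rewrite (_ : 4`! = 24)%N//; field.
have Fs j : ~~ (2 %| j)%N -> mf_chain 1 0 (4 + j) 0 = 0 :> R.
  by rewrite dvdn2 negbK => jodd; rewrite mf_chain3E lncosh_chain_odd//= !negbK.
have ev : ~~ odd (2 * M.+1) by rewrite oddM.
have gap del : 0 < del -> exists2 eta, 0 < eta & forall t : R, true -> del <= `|t| ->
    mf_phi 1 0 (0 + t) - mf_phi 1 0 0 <= - eta.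
  move=> del0; have [eta eta0 H] := mf_gap_zero (@ltr01 R) erefl (lexx 1) del0.
  by exists eta => // t _; exact: H.
have HI n : (1 <= n)%N -> has_integral setT
    (fun t => if true then expR (n%:R * (mf_phi 1 0 (0 + t) - mf_phi 1 0 0)) else 0)
    (scaled_partition d beta 0 0 n * Num.sqrt (2 * pi * (1 / n%:R)) / 1).
  by move=> n1; have := has_integral_scaled 0 0 n1 b0; rewrite bE divr1.
have c0 : 0 < 12^-1 :> R by [].
have [C HC] := normalized_expansion ltr01 ltr01 (fun n _ => erefl)
  (mf_expansion ltr01 (lexx 0) (isT : (0 < 4)%N) isT (isT : (0 < 2)%N) ev c0 ltr01
     (fun _ _ => isT) Fj Fr Fs gap HI).
apply: (@expands_as_powR _ _ _ _ _ (scaled_partition d beta 0 0) C (1 / 2)) => //.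
- by move=> n _; rewrite {1}(scaled_partitionE d beta 0 0) mf_phi00 mulr0 expR0 mulr1.
have exponent m : 1 / 2 - (2 * m).+1%:R / 4%:R = - (m%:R / 2) + 1 / 4 :> R.
  by rewrite -[(2 * m).+1%:R]natr1 natrM; field.
move=> n n1; have nR : 0 < n%:R :> R by rewrite ltr0n.
have := HC n n1; rewrite exponent.
have -> : n%:R `^ (- (M.+1%:R / 2) + 1 / 4) =
    n%:R `^ (- (1 / 2)) * n%:R `^ (- (M%:R / 2) + 1 / 4) :> R.
  rewrite -powRD; last by rewrite (gt_eqF nR) implybT.
  by congr (_ `^ _); rewrite -natr1; field.
rewrite -[C * _ * _]mulrA.
move=> H; apply: le_trans H; rewrite le_eqVlt; apply/orP; left; apply/eqP.
congr (`|_ - _|); rewrite big_mkord; apply: eq_bigr => -[p /= _] _.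
rewrite exponent; congr (_ * _); rewrite mulr1 /laplace_coef oddM/=.
pose g k : R := 12 `^ (p%:R / 2 + k%:R) * Gamma (p%:R / 2 + k%:R + 1 / 4) / k`!%:R
  * composition_sum (fun m => taylor_coef (@lncosh R) 0 (2 * m + 4)) k p.
have quarter : 2 / 4 * 12 `^ (1 / 4) = (3 / 4) `^ (1 / 4) :> R.
  have -> : 3 / 4 = (1 / 2) `^ 4%:R * 12 :> R by rewrite powR_mulrn//; field.
  rewrite powRM ?powR_ge0// -powRrM (_ : 4%:R * (1 / 4) = 1 :> R); last by field.
  by rewrite powRr1//; congr (_ * _); field.
rewrite (eq_bigr (fun k => (3 / 4) `^ (1 / 4) * g k)); last first.
  move=> k _; rewrite /g -quarter.
  have -> : (2 * p).+1%:R / 4%:R + k%:R = p%:R / 2 + k%:R + 1 / 4 :> R.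
    by rewrite -natr1 natrM; field.
  have -> : 12^-1 `^ (- (p%:R / 2 + k%:R + 1 / 4)) =
      12 `^ (p%:R / 2 + k%:R) * 12 `^ (1 / 4) :> R.
    rewrite -powRD; last by rewrite (pnatr_eq0 R 12) implybT.
    by rewrite -powR_inv1// -powRrM; congr (_ `^ _); ring.
  rewrite (@eq_composition_sum _ _ (fun m => taylor_coef (@lncosh R) 0 (2 * m + 4))).
    by field; rewrite pnatr_eq0 -lt0n fact_gt0.
  move=> m _; rewrite addnC addn4; exact: taylor_coef_mf_lncosh.
rewrite -mulr_sumr mulrA /e_crit; case: eqP => [p00|/eqP p0].
  rewrite p00 big_nat1 /g composition_sum0 p00 eqxx fact0 mul0r !add0r powRr0.
  by rewrite mulr1 divr1 [X in _ = _ * X]mul1r.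
have g0 : g 0%N = 0 by rewrite /g composition_sum_pos0 ?lt0n// mulr0.
by rewrite [in RHS]big_ltn// g0 add0r.
Qed.

(** By symmetry the maximizers ts and - ts contribute equally, which is the factor 2 absorbed
    into the prefactors of the coefficients. *)
Lemma supercritical_expansion (M : nat) (ts : R) : 0 < beta ->
  mf_maximizer (2 * d%:R * beta) 0 ts ->
  expands_as (partition_function d beta 0)
    (fun n => 2 ^+ n * expR (n%:R * phi_zero d beta ts))
    (fun n => \sum_(0 <= p < M.+1) e_super d beta ts p * n%:R ^- p) (fun n => n%:R ^- M).
Proof.
move=> beta0 tsmax; set b := 2 * d%:R * beta in tsmax.
have b0 : 0 < b by rewrite !mulr_gt0.
have [ts0 ch1 ch2 _ _] := tsmax.
have [_ a2E _ a2c] := maximizer_taylor b0 tsmax.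
have Dts t : `|t| <= ts -> - ts <= t by rewrite ler_norml => /andP[].
have [C HC] := saddle_expansion M b0 (lexx 0) (ltr0n _ 2) ts0 Dts ch1 ch2
  (mf_gap_halfline b0 tsmax) (fun n n1 => has_integral_scaled_right ts n1 b0).
apply: (@expands_as_powR _ _ _ _ _ (scaled_partition d beta 0 ts) C 1) => //.
- by move=> n _; rewrite phi_zeroE// {1}(scaled_partitionE d beta 0 ts).
move=> n n1; apply: le_trans (HC n n1); rewrite le_eqVlt; apply/orP; left; apply/eqP.
congr (`|_ - _|); apply: eq_bigr => p _; congr (_ * _).
rewrite /e_super (phi_zeroE beta0) -/b in a2E a2c *.
set a := taylor_coef (mf_phi b 0) ts in a2E a2c *.
rewrite !a2c; set c := - (mf_chain b 0 2 ts / 2) in a2c *.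
have a2N : a 2%N = - c by move: a2c; lra.
have c0 : 0 < c by rewrite oppr_gt0 pmulr_llt0// invr_gt0.
have db0 : 0 < d%:R * beta by rewrite mulr_gt0.
have two : 2 * (2 * b * c) `^ (- (1 / 2)) = (d%:R * beta * c) `^ (- (1 / 2)).
  have -> : 2 * b * c = 2 `^ 2%:R * (d%:R * beta * c) by rewrite powR_mulrn// /b; ring.
  rewrite powRM ?powR_ge0 ?(ltW (mulr_gt0 db0 c0))//.
  rewrite -powRrM (_ : 2%:R * - (1 / 2) = -1 :> R); last by field.
  by rewrite powR_inv1// mulVKf// (pnatr_eq0 R 2).
rewrite two; case: eqP => [->|/eqP p0].
  rewrite gauss_sum0 mulr1.
  have -> : 1 / b - 1 / cosh ts ^+ 2 = 2 * c by rewrite a2c a2E; ring.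
  rewrite [in RHS]powRM ?(ltW db0) ?(ltW c0)// [(2 * c) `^ _]powRM ?(ltW c0)//.
  by rewrite [2 `^ - _]powRN; field; rewrite gt_eqF// powR_gt0.
rewrite gauss_sum_pos ?lt0n//.
by congr (_ `^ _ * _); rewrite a2N; ring.
Qed.

(** Flipping all spins changes the sign of h, so h may be taken positive; the only
    maximizer is then the positive one. *)
Lemma field_expansion (M : nat) (h ts : R) : 0 < beta -> h != 0 ->
  mf_maximizer (2 * d%:R * beta) `|h| ts ->
  expands_as (partition_function d beta h)
    (fun n => 2 ^+ n * expR (n%:R * phi_field d beta h ts))
    (fun n => \sum_(0 <= p < M.+1) e_field d beta h ts p * n%:R ^- p) (fun n => n%:R ^- M).
Proof.
move=> beta0 hneq0 tsmax; set b := 2 * d%:R * beta in tsmax.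
have b0 : 0 < b by rewrite !mulr_gt0.
have h0 : 0 < `|h| by rewrite normr_gt0.
have [ts0 ch1 ch2 _ _] := tsmax.
have [_ a2E _ a2c] := maximizer_taylor b0 tsmax.
have gap del : 0 < del -> exists2 eta, 0 < eta & forall t : R, true -> del <= `|t| ->
    mf_phi b `|h| (ts + t) - mf_phi b `|h| ts <= - eta.
  move=> del0; have [eta eta0 H] := mf_gap_line b0 (ltW h0) tsmax h0 del0.
  by exists eta => // t _; exact: H.
have HI n : (1 <= n)%N -> has_integral setT
    (fun t => if true then expR (n%:R * (mf_phi b `|h| (ts + t) - mf_phi b `|h| ts)) else 0)
    (scaled_partition d beta `|h| ts n * Num.sqrt (2 * pi * (b / n%:R)) / 1).
  by move=> n1; rewrite divr1; exact: has_integral_scaled.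
have [C HC] := saddle_expansion M b0 (ltW h0) ltr01 ts0 (fun _ _ => isT) ch1 ch2 gap HI.
apply: (@expands_as_powR _ _ _ _ _ (scaled_partition d beta `|h| ts) C 1) => //.
- move=> n _; rewrite phi_fieldE// -(partition_function_norm d n beta h).
  by rewrite {1}(scaled_partitionE d beta `|h| ts).
move=> n n1; apply: le_trans (HC n n1); rewrite le_eqVlt; apply/orP; left; apply/eqP.
congr (`|_ - _|); apply: eq_bigr => p _; congr (_ * _).
rewrite /e_field (phi_fieldE h beta0) -/b in a2E a2c *.
set a := taylor_coef (mf_phi b `|h|) ts in a2E a2c *.
rewrite !a2c (mul1r (_ `^ _)); set c := - (mf_chain b `|h| 2 ts / 2) in a2c *.
have a2N : a 2%N = - c by move: a2c; lra.
have c0 : 0 < c by rewrite oppr_gt0 pmulr_llt0// invr_gt0.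
case: eqP => [->|/eqP p0].
  rewrite gauss_sum0 mulr1 -powRM ?(ltW b0)//.
    congr (_ `^ _); have -> : 1 / b - 1 / cosh ts ^+ 2 = 2 * c by rewrite a2c a2E; ring.
    by ring.
  rewrite (_ : 1 / b - 1 / cosh ts ^+ 2 = 2 * c); first by rewrite mulr_ge0// ltW.
  by rewrite a2c a2E; ring.
rewrite gauss_sum_pos ?lt0n//.
by congr (_ `^ _ * _); rewrite a2N /b; ring.
Qed.

End theorem_cases.

Unset Implicit Arguments.
Set Strict Implicit.
Set Printing Implicit Defensive.

Theorem theorem1p1 (R : realType) (d : nat) (beta h : R)
    (d_ge1 : (1 <= d)%N) (beta_ge0 : 0 <= beta) :
  [/\ (* (1) *)
      h = 0 -> beta < beta_c R d ->
      forall M : nat, (1 <= M)%N ->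
      expands_as (partition_function d beta h)
        (fun n => 2 ^+ n)
        (fun n => \sum_(0 <= p < M.+1) e_sub d beta p * n%:R ^- p)
        (fun n => n%:R ^- M),
      (* (2) *)
      h = 0 -> beta = beta_c R d ->
      forall M : nat, (1 <= M)%N ->
      expands_as (partition_function d beta h)
        (fun n => 2 ^+ n)
        (fun n => \sum_(0 <= p < M.+1)
                    e_crit R p * n%:R `^ (- (p%:R / 2) + 1 / 4))
        (fun n => n%:R `^ (- (M%:R / 2) + 1 / 4)),
      (* (3) *)
      h = 0 -> beta_c R d < beta ->
      exists z : R,
        let t := 2 * d%:R * beta * z in
        let a := taylor_coef (phi_zero d beta) t in
        [/\ 0 < z,
            maximal_fixpoint (fun y => tanh (beta / beta_c R d * y)) z,
            a 1%N = 0,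
            2 * a 2%N = 1 / cosh t ^+ 2 - 1 / (2 * d%:R * beta) /\
            2 * a 2%N < 0 &
            forall M : nat, (1 <= M)%N ->
            expands_as (partition_function d beta h)
              (fun n => 2 ^+ n * expR (n%:R * phi_zero d beta t))
              (fun n => \sum_(0 <= p < M.+1) e_super d beta t p * n%:R ^- p)
              (fun n => n%:R ^- M)]
    & (* (4) *)
      h != 0 -> 0 < beta ->
      exists z : R,
        let t := 2 * d%:R * beta * z + `|h| in
        let a := taylor_coef (phi_field d beta h) t in
        [/\ 0 < z,
            maximal_fixpoint (fun y => tanh (beta / beta_c R d * y + `|h|)) z,
            a 1%N = 0,
            2 * a 2%N = 1 / cosh t ^+ 2 - 1 / (2 * d%:R * beta) /\
            2 * a 2%N < 0 &
            forall M : nat, (1 <= M)%N ->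
            expands_as (partition_function d beta h)
              (fun n => 2 ^+ n * expR (n%:R * phi_field d beta h t))
              (fun n => \sum_(0 <= p < M.+1) e_field d beta h t p * n%:R ^- p)
              (fun n => n%:R ^- M)]].
Proof.
have d0 : 0 < d%:R :> R by rewrite ltr0n.
have bE : beta / beta_c R d = 2 * d%:R * beta.
  by rewrite /beta_c; field; rewrite gt_eqF.
have supercritical : beta_c R d < beta -> 0 < beta /\ 1 < 2 * d%:R * beta.
  move=> bc; have bc0 : 0 < beta_c R d by rewrite /beta_c divr_gt0// mulr_gt0.
  by rewrite (lt_trans bc0 bc); split=> //; rewrite -bE ltr_pdivlMr// mul1r.
split.
- move=> -> bc M _; move: beta_ge0; rewrite le_eqVlt => /predU1P[/esym beta0|beta0].
    exact: infinite_temperature_expansion.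
  exact: subcritical_expansion.
- by move=> -> bc M _; exact: critical_expansion.
- move=> -> /supercritical[beta0 b1].
  have b0 : 0 < 2 * d%:R * beta by rewrite !mulr_gt0.
  have [ts tsmax] := mf_maximizer_exists b0 (lexx 0) (or_intror b1).
  have [z0 bz zmax] := maximizer_fixpoint b0 tsmax (lexx 0).
  have [a1 a2 a2neg _] := maximizer_taylor b0 tsmax.
  exists ((ts - 0) / (2 * d%:R * beta)); cbv zeta.
  rewrite -[2 * d%:R * beta * (_ / _)]addr0 bz phi_zeroE//; split => //.
    rewrite bE (_ : (fun y => _) = (fun y => tanh (2 * d%:R * beta * y + 0)))//.
    by apply/funext => y; rewrite addr0.
  by move=> M _; rewrite -phi_zeroE//; exact: supercritical_expansion.
- move=> hneq0 beta0; have h0 : 0 < `|h| by rewrite normr_gt0.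
  have b0 : 0 < 2 * d%:R * beta by rewrite !mulr_gt0.
  have [ts tsmax] := mf_maximizer_exists b0 (ltW h0) (or_introl h0).
  have [z0 bz zmax] := maximizer_fixpoint b0 tsmax (ltW h0).
  have [a1 a2 a2neg _] := maximizer_taylor b0 tsmax.
  exists ((ts - `|h|) / (2 * d%:R * beta)); cbv zeta.
  rewrite bz phi_fieldE//; split => //; first by rewrite bE.
  by move=> M _; rewrite -phi_fieldE//; exact: field_expansion.
Qed.
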